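(* The restriction of the functor $\nu$ (from augmented directed complexes to $\omega$-categories) to the category of simple augmented directed complexes is a fully faithful embedding in the category of $\omega$-categories, with image equivalent to the category $\Theta$ of simple $\omega$-categories.
   Context: $\omega$-categories. All $\omega$-categories are strict. An $\omega$-category is a single set with partially defined binary composition operations $\#_0,\#_1,\ldots$, each of which makes it the set of morphisms of a small category. The left identity of $x$ under $\#_n$ is denoted $d_n^-x$ and the right identity $d_n^+x$, so $x\#_n y$ is defined exactly when $d_n^+x=d_n^-y$. The category structures commute with one another (that is, for $m\neq n$ the identity and composition operations of one structure are functorial for the other, including the interchange law), with $d_m^\beta d_n^\alpha x=d_n^\alpha d_m^\beta x=d_m^\beta x$ for $m<n$ and all signs $\alpha,\beta$; and every element $x$ is an identity for some $\#_m$. Morphisms of $\omega$-categories are functions preserving all the identities and composites. Simple globular sets. A globular set is a set in which every element $x$ has a dimension $|x|\in\{0,1,2,\ldots\}$, every $x$ with $|x|>0$ is assigned two $(|x|-1)$-dimensional elements $\partial^-x,\partial^+x$, and $\partial^-\partial^-x=\partial^-\partial^+x$, $\partial^+\partial^-x=\partial^+\partial^+x$ if $|x|\geq 2$. It is simple if it is non-empty and finite and the transitive closure of the relation given by $\partial^-x<x$ and $x<\partial^+x$ is a (strict) total ordering. Simple $\omega$-categories. The free $\omega$-category on a globular set is the $\omega$-category presented by taking the members of the globular set as generators, with relations $d_n^-x=d_n^+x=x$ for every $n$-dimensional generator $x$, and $d_{n-1}^-x=\partial^-x$, $d_{n-1}^+x=\partial^+x$ for every $n$-dimensional generator $x$ with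 $n>0$. A simple $\omega$-category is the free $\omega$-category on a simple globular set. $\Theta$ is the full subcategory of the category of $\omega$-categories whose objects are the simple $\omega$-categories. Augmented directed complexes. An augmented directed complex is an augmented chain complex $K$ of abelian groups concentrated in nonnegative dimensions (boundary $\partial$, augmentation $\epsilon\colon K_0\to\mathbf{Z}$), together with a distinguished submonoid $K_q^*$ of each chain group $K_q$. A morphism $K\to L$ is an augmentation-preserving chain map taking $K_q^*$ into $L_q^*$ for each $q$. The resulting category is $\mathbf{adc}$. A globular set $X$ generates an augmented directed complex: $K_q$ is the free abelian group on the $q$-dimensional elements of $X$, $K_q^*$ is the submonoid generated by these basis elements, $\epsilon x=1$ for $x\in X$ with $|x|=0$, and $\partial x=\partial^+x-\partial^-x$ for $x\in X$ with $|x|>0$. A simple augmented directed complex is one generated by a simple globular set; the category of simple augmented directed complexes is the corresponding full subcategory of $\mathbf{adc}$. The functor $\nu$. For an augmented directed complex $K$, the $\omega$-category $\nu K$ consists of the double sequences $(x_0^-,x_0^+\mid x_1^-,x_1^+\mid\ldots)$ such that $x_q^\alpha\in K_q^*$; $x_q^-=x_q^+=0$ for all but finitely many $q$; $\epsilon x_0^-=\epsilon x_0^+=1$; and $x_q^+-x_q^-=\partial x_{q+1}^-=\partial x_{q+1}^+$ for all $q\geq 0$. The identities are $d_n^\alpha x=(x_0^-,x_0^+\mid\ldots\mid x_{n-1}^-,x_{n-1}^+\mid x_n^\alpha,x_n^\alpha\mid 0,0\mid\ldots)$, and if $d_n^+x=d_n^-y=z$ then $x\#_n y=x-z+y$ (termwise).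 A morphism of augmented directed complexes acts termwise. *)

(* Defs.v *)
(* Steiner's functor nu on simple augmented directed complexes, over the
   Mathematical Components library.  A sign is a boolean: [false] stands for
   the sign - and [true] for the sign +. *)
From HB Require Import structures.
From Stdlib Require Import Relation_Operators.
From mathcomp Require Import all_boot all_order all_algebra.
From mathcomp Require Import boolp.
From mathcomp Require Import freeg.

Set Implicit Arguments.
Unset Strict Implicit.
Unset Printing Implicit Defensive.

Import GRing.Theory.
Local Open Scope ring_scope.
Local Obligation Tactic := idtac.

(** * Categories *)

(* [ccomp g f] is the composite of f followed by g. *)
Record category := Category {
  obj :> Type;
  hom : obj -> obj -> Type;
  idm : forall a, hom a a;
  ccomp : forall a b c, hom b c -> hom a b -> hom a c;
  ccomp_idl : forall a b (f : hom a b), ccomp (idm b) f = f;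
  ccomp_idr : forall a b (f : hom a b), ccomp f (idm a) = f;
  ccompA : forall a b c d (h : hom c d) (g : hom b c) (f : hom a b),
    ccomp h (ccomp g f) = ccomp (ccomp h g) f
}.
Arguments hom {_} _ _.
Arguments idm {_} _.
Arguments ccomp {_ _ _ _} _ _.

Definition is_iso (C : category) (a b : C) (f : hom a b) : Prop :=
  exists g : hom b a, ccomp g f = idm a /\ ccomp f g = idm b.

Definition isomorphic (C : category) (a b : C) : Prop :=
  exists f : hom a b, is_iso f.

Record functor (C D : category) := Functor {
  fobj :> C -> D;
  fmap : forall a b, hom a b -> hom (fobj a) (fobj b);
  fmap_id : forall a, fmap (idm a) = idm (fobj a);
  fmap_comp : forall a b c (g : hom b c) (f : hom a b),
    fmap (ccomp g f) = ccomp (fmap g) (fmap f)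
}.
Arguments fmap {C D} _ {a b} _.

Definition id_functor (C : category) : functor C C :=
  @Functor C C (fun a => a) (fun _ _ f => f)
    (fun _ => erefl) (fun _ _ _ _ _ => erefl).

Program Definition comp_functor (C D E : category) (G : functor D E)
    (F : functor C D) : functor C E :=
  @Functor C E (fun a => G (F a)) (fun _ _ f => fmap G (fmap F f)) _ _.
Next Obligation. by move=> C D E G F a /=; rewrite !fmap_id. Qed.
Next Obligation. by move=> C D E G F a b c g f /=; rewrite !fmap_comp. Qed.

Definition naturally_isomorphic (C D : category) (F G : functor C D) : Prop :=
  exists eta : forall a, hom (F a) (G a),
    (forall a, is_iso (eta a)) /\
    (forall a b (f : hom a b),
       ccomp (eta b) (fmap F f) = ccomp (fmap G f) (eta a)).

Definition equivalent_categories (C D : category) : Prop :=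
  exists (F : functor C D) (G : functor D C),
    naturally_isomorphic (comp_functor G F) (id_functor C) /\
    naturally_isomorphic (comp_functor F G) (id_functor D).

Definition faithful (C D : category) (F : functor C D) : Prop :=
  forall a b, injective (fun f : hom a b => fmap F f).

Definition full (C D : category) (F : functor C D) : Prop :=
  forall a b (g : hom (F a) (F b)), exists f : hom a b, fmap F f = g.

(* The embedding clause is injectivity on objects up to isomorphism. *)
Definition fully_faithful_embedding (C D : category) (F : functor C D) : Prop :=
  [/\ full F, faithful F
    & forall a b : C, isomorphic (F a) (F b) -> isomorphic a b].

Definition full_subcategory (C : category) (P : C -> Prop) : category :=
  @Category {a : C | P a} (fun a b => hom (sval a) (sval b))
    (fun a => idm (sval a)) (fun _ _ _ g f => ccomp g f)
    (fun _ _ f => ccomp_idl f) (fun _ _ f => ccomp_idr f)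
    (fun _ _ _ _ h g f => ccompA h g f).

Definition restriction (C D : category) (F : functor C D) (P : C -> Prop) :
    functor (full_subcategory P) D :=
  @Functor (full_subcategory P) D (fun a => F (sval a)) (fun _ _ f => fmap F f)
    (fun a => fmap_id F (sval a)) (fun _ _ _ g f => fmap_comp F g f).

(* When F identifies objects, the morphisms [fmap F f] need not be closed under
   composition, so the image is the subcategory that they generate. *)
Inductive image_mor (C D : category) (F : functor C D) :
    forall a b : D, hom a b -> Prop :=
| image_fmap (x y : C) (f : hom x y) : image_mor F (fmap F f)
| image_ccomp (a b c : D) (g : hom b c) (f : hom a b) :
    image_mor F g -> image_mor F f -> image_mor F (ccomp g f).

Lemma image_idm (C D : category) (F : functor C D)
    (a : {a : D | exists x, F x = a}) : image_mor F (idm (sval a)).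
Proof. by case: a => a /= [x <-]; rewrite -fmap_id; exact: image_fmap. Qed.

Program Definition image (C D : category) (F : functor C D) : category :=
  @Category {a : D | exists x, F x = a}
    (fun a b => {f : hom (sval a) (sval b) | image_mor F f})
    (fun a => exist _ (idm (sval a)) (image_idm a))
    (fun _ _ _ g f =>
       exist _ (ccomp (sval g) (sval f)) (image_ccomp (svalP g) (svalP f)))
    _ _ _.
Next Obligation. by move=> C D F a b [f ?]; apply: eq_exist; exact: ccomp_idl. Qed.
Next Obligation. by move=> C D F a b [f ?]; apply: eq_exist; exact: ccomp_idr. Qed.
Next Obligation.
by move=> C D F a b c d [h ?] [g ?] [f ?]; apply: eq_exist; exact: ccompA.
Qed.

(** * Strict omega-categories *)

(* [src_tgt n false x] and [src_tgt n true x] are the left and right identities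
   d_n^- x and d_n^+ x; the relation [ocomp n x y z] says that x #_n y is
   defined and equal to z. *)
Record omega_category := OmegaCategory {
  ocar :> Type;
  src_tgt : nat -> bool -> ocar -> ocar;
  ocomp : nat -> ocar -> ocar -> ocar -> Prop;
  ocomp_fun : forall n x y z z', ocomp n x y z -> ocomp n x y z' -> z = z';
  ocomp_def : forall n x y,
    (exists z, ocomp n x y z) <-> src_tgt n true x = src_tgt n false y;
  src_tgt_idem : forall n a b x, src_tgt n a (src_tgt n b x) = src_tgt n b x;
  src_ocomp : forall n x y z,
    ocomp n x y z -> src_tgt n false z = src_tgt n false x;
  tgt_ocomp : forall n x y z,
    ocomp n x y z -> src_tgt n true z = src_tgt n true y;
  ocomp_idl : forall n x, ocomp n (src_tgt n false x) x x;
  ocomp_idr : forall n x, ocomp n x (src_tgt n true x) x;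
  ocompA : forall n x y z u v w,
    ocomp n x y u -> ocomp n y z v -> ocomp n u z w -> ocomp n x v w;
  src_tgt_comm : forall m n a b x, m <> n ->
    src_tgt m a (src_tgt n b x) = src_tgt n b (src_tgt m a x);
  src_tgt_ocomp : forall m n a x y z, m <> n ->
    ocomp n x y z ->
    ocomp n (src_tgt m a x) (src_tgt m a y) (src_tgt m a z);
  interchange : forall m n x y z w xy zw xz yw, m <> n ->
    ocomp m x y xy -> ocomp m z w zw -> ocomp n x z xz -> ocomp n y w yw ->
    exists2 t, ocomp n xy zw t & ocomp m xz yw t;
  src_tgt_low : forall m n a b x, (m < n)%N ->
    src_tgt m b (src_tgt n a x) = src_tgt m b x /\
    src_tgt n a (src_tgt m b x) = src_tgt m b x;
  ocat_finite : forall x, exists m, src_tgt m false x = x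
}.
Arguments src_tgt {_} _ _ _.
Arguments ocomp {_} _ _ _ _.

Record omega_morphism (C D : omega_category) (f : C -> D) : Prop :=
  OmegaMorphism {
    omor_src_tgt : forall n a x, f (src_tgt n a x) = src_tgt n a (f x);
    omor_ocomp : forall n x y z, ocomp n x y z -> ocomp n (f x) (f y) (f z)
  }.

Definition omega_hom (C D : omega_category) := {f : C -> D | omega_morphism f}.

Lemma omega_morphism_id (C : omega_category) : omega_morphism (fun x : C => x).
Proof. by []. Qed.

Lemma omega_morphism_comp (C D E : omega_category)
    (g : omega_hom D E) (f : omega_hom C D) :
  omega_morphism (fun x => sval g (sval f x)).
Proof.
case: g f => [g [g1 g2]] [f [f1 f2]]; split=> /= [n a x|n x y z xyz].
  by rewrite f1 g1.
exact/g2/f2.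
Qed.

Program Definition OmegaCat : category :=
  @Category omega_category omega_hom
    (fun C => exist _ _ (omega_morphism_id C))
    (fun _ _ _ g f => exist _ _ (omega_morphism_comp g f)) _ _ _.
Next Obligation. by move=> C D [f ?]; exact: eq_exist. Qed.
Next Obligation. by move=> C D [f ?]; exact: eq_exist. Qed.
Next Obligation. by move=> A B C D [h ?] [g ?] [f ?]; exact: eq_exist. Qed.

(** * Simple globular sets *)

(* [gface a x] is the face of x with sign a; its value is irrelevant when
   [gdim x = 0]. *)
Record globular_set := GlobularSet {
  gcar :> choiceType;
  gdim : gcar -> nat;
  gface : bool -> gcar -> gcar;
  gdim_face : forall a x, (0 < gdim x)%N -> gdim (gface a x) = (gdim x).-1;
  gface_face : forall a x, (2 <= gdim x)%N ->
    gface a (gface false x) = gface a (gface true x)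
}.
Arguments gdim {_} _.
Arguments gface {_} _ _.

Inductive glob_step (X : globular_set) : X -> X -> Prop :=
| glob_step_src (x : X) : (0 < gdim x)%N -> glob_step (gface false x) x
| glob_step_tgt (x : X) : (0 < gdim x)%N -> glob_step x (gface true x).

Definition glob_lt (X : globular_set) : X -> X -> Prop :=
  clos_trans X (@glob_step X).

Definition strict_total_order (T : Type) (R : T -> T -> Prop) : Prop :=
  [/\ forall x, ~ R x x,
      forall x y z, R x y -> R y z -> R x z
    & forall x y, [\/ R x y, x = y | R y x]].

Definition simple_globular_set (X : globular_set) : Prop :=
  [/\ exists x : X, True,
      exists s : seq X, forall x, x \in s
    & strict_total_order (@glob_lt X)].

(** * Simple omega-categories *)

Definition globular_relations (X : globular_set) (C : omega_category)
    (i : X -> C) : Prop :=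
  forall a x,
    src_tgt (gdim x) a (i x) = i x /\
    ((0 < gdim x)%N -> src_tgt (gdim x).-1 a (i x) = i (gface a x)).

Definition free_on (X : globular_set) (C : omega_category) (i : X -> C) : Prop :=
  globular_relations i /\
  forall (D : omega_category) (j : X -> D), globular_relations j ->
    exists! f : omega_hom C D, forall x, sval f (i x) = j x.

Definition simple_omega_category (C : omega_category) : Prop :=
  exists (X : globular_set) (i : X -> C),
    simple_globular_set X /\ free_on i.

Definition Theta : category :=
  @full_subcategory OmegaCat simple_omega_category.

(** * Augmented directed complexes *)

Record adc := Adc {
  chain :> nat -> zmodType;
  bd : forall q, {additive chain q.+1 -> chain q};
  aug : {additive chain 0 -> int};
  positive : forall q, chain q -> Prop;
  bd_bd : forall q x, bd q (bd q.+1 x) = 0;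
  aug_bd : forall x, aug (bd 0 x) = 0;
  positive0 : forall q, positive (0 : chain q);
  positiveD : forall q (x y : chain q),
    positive x -> positive y -> positive (x + y)
}.
Arguments bd {_} _.
Arguments aug {_}.
Arguments positive {_ _} _.

Record adc_morphism (K L : adc) (f : forall q, K q -> L q) : Prop :=
  AdcMorphism {
    amor_additive : forall q, zmod_morphism (f q);
    amor_bd : forall q x, f q (bd q x) = bd q (f q.+1 x);
    amor_aug : forall x, aug (f 0 x) = aug x;
    amor_positive : forall q (x : K q), positive x -> positive (f q x)
  }.

Definition adc_hom (K L : adc) := {f : forall q, K q -> L q | adc_morphism f}.

Lemma adc_morphism_id (K : adc) : adc_morphism (fun q (x : K q) => x).
Proof. by []. Qed.

Lemma adc_morphism_comp (K L M : adc) (g : adc_hom L M) (f : adc_hom K L) :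
  adc_morphism (fun q x => sval g q (sval f q x)).
Proof.
case: g f => [g [g1 g2 g3 g4]] [f [f1 f2 f3 f4]]; split=> /=.
- by move=> q x y; rewrite f1 g1.
- by move=> q x; rewrite f2 g2.
- by move=> x; rewrite g3 f3.
- by move=> q x /f4/g4.
Qed.

Program Definition ADC : category :=
  @Category adc adc_hom
    (fun K => exist _ _ (adc_morphism_id K))
    (fun _ _ _ g f => exist _ _ (adc_morphism_comp g f)) _ _ _.
Next Obligation. by move=> K L [f ?]; exact: eq_exist. Qed.
Next Obligation. by move=> K L [f ?]; exact: eq_exist. Qed.
Next Obligation. by move=> J K L M [h ?] [g ?] [f ?]; exact: eq_exist. Qed.

(** * The complex generated by a globular set *)

Inductive generated_submonoid (M : nmodType) (B : M -> Prop) : M -> Prop :=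
| gen_base x : B x -> generated_submonoid B x
| gen_zero : generated_submonoid B 0
| gen_add x y : generated_submonoid B x -> generated_submonoid B y ->
    generated_submonoid B (x + y).

Definition gcell (X : globular_set) (q : nat) := {x : X | gdim x == q}.

Lemma gcell_face_subproof (X : globular_set) q (a : bool) (x : gcell X q.+1) :
  gdim (gface a (val x)) == q.
Proof. by case: x => x /= /eqP xq; rewrite gdim_face xq. Qed.

Definition gcell_face (X : globular_set) q (a : bool) (x : gcell X q.+1) :
    gcell X q :=
  exist _ (gface a (val x)) (gcell_face_subproof a x).

Lemma gcell_face_face (X : globular_set) q (a : bool) (x : gcell X q.+2) :
  gcell_face a (gcell_face false x) = gcell_face a (gcell_face true x).
Proof.
by apply: val_inj; case: x => x /= /eqP xq; apply: gface_face; rewrite xq.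
Qed.

Definition gen_bd_fun (X : globular_set) q :
    {freeg (gcell X q.+1)} -> {freeg (gcell X q)} :=
  fglift (fun x => << gcell_face true x >> - << gcell_face false x >>).

HB.instance Definition _ (X : globular_set) q :=
  GRing.isZmodMorphism.Build {freeg (gcell X q.+1)} {freeg (gcell X q)}
    (@gen_bd_fun X q) (lift_is_additive _).

Lemma freeg_additive0 (T : choiceType) (V : zmodType)
    (f : {additive {freeg T} -> V}) :
  (forall x, f << x >> = 0) -> forall D, f D = 0.
Proof.
move=> f0 D; rewrite -(freeg_sumE D) raddf_sum big1 // => x _.
suff -> : << coeff x D *g x >> = << x >> *~ coeff x D :> {freeg T}.
  by rewrite raddfMz f0 mul0rz.
apply/eqP/freeg_eqP => y; rewrite coeffU raddfMz /= coeffU mul1r.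
by rewrite -mulrzl intz.
Qed.

Lemma gen_bdU (X : globular_set) q (x : gcell X q.+1) :
  gen_bd_fun << x >> = << gcell_face true x >> - << gcell_face false x >>.
Proof. by rewrite /gen_bd_fun liftU scale1r. Qed.

Lemma gen_bd_bd (X : globular_set) q (D : {freeg (gcell X q.+2)}) :
  gen_bd_fun (gen_bd_fun D) = 0.
Proof.
move: D; apply: (@freeg_additive0 _ _ (@gen_bd_fun X q \o @gen_bd_fun X q.+1)).
by move=> x /=; rewrite gen_bdU raddfB /= !gen_bdU !gcell_face_face subrr.
Qed.

Lemma gen_aug_bd (X : globular_set) (D : {freeg (gcell X 1)}) :
  deg (gen_bd_fun D) = 0.
Proof.
move: D; apply: (@freeg_additive0 _ _ (@deg _ \o @gen_bd_fun X 0)).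
by move=> x /=; rewrite gen_bdU raddfB /= !degU subrr.
Qed.

(* [deg] is the additive map sending every basis element to 1. *)
Definition adc_of_globular_set (X : globular_set) : adc :=
  @Adc (fun q => {freeg (gcell X q)})
    (fun q => @gen_bd_fun X q)
    (@deg (gcell X 0))
    (fun q => generated_submonoid (fun D => exists x, D = << x >>))
    (@gen_bd_bd X) (@gen_aug_bd X)
    (fun q => gen_zero _) (fun q x y => @gen_add _ _ x y).

(* Simple complexes are closed under isomorphism, like the simple
   omega-categories. *)
Definition simple_adc (K : adc) : Prop :=
  exists X : globular_set,
    simple_globular_set X /\ @isomorphic ADC K (adc_of_globular_set X).

Definition SimpleADC : category := @full_subcategory ADC simple_adc.

(** * The functor nu *)

Section Nu.
Variable K : adc.

Definition double_sequence := forall q, bool -> K q.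

Record in_nu (x : double_sequence) : Prop := InNu {
  nu_positive : forall q a, positive (x q a);
  nu_finite : exists N, forall q a, (N <= q)%N -> x q a = 0;
  nu_aug : forall a, aug (x 0 a) = 1;
  nu_bd : forall q a, x q true - x q false = bd q (x q.+1 a)
}.

Definition nu_car := {x : double_sequence | in_nu x}.

Definition nu_src_tgt_seq n a (x : double_sequence) : double_sequence :=
  fun q b => if (q < n)%N then x q b else if q == n then x q a else 0.

Lemma nu_src_tgt_subproof n a (x : nu_car) :
  in_nu (nu_src_tgt_seq n a (sval x)).
Proof.
case: x => x [xpos [N xfin] xaug xbd] /=; rewrite /nu_src_tgt_seq; split.
- by move=> q b; case: ltngtP => // _; exact: positive0.
- by exists n.+1 => q b; case: ltngtP.
- by move=> b; case: ltngtP.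
- move=> q b; case: (ltngtP q n) => [qn|nq|<-].
  + case: (ltngtP q.+1 n) => [_|nq|_]; rewrite -?xbd//.
    by move: nq; rewrite ltnS leqNgt qn.
  + by rewrite ltnNge (leqW (ltnW nq)) /= gtn_eqF ?(leqW nq)// subrr raddf0.
  + by rewrite ltnNge leqnSn /= gtn_eqF// subrr raddf0.
Qed.

Definition nu_src_tgt n a (x : nu_car) : nu_car :=
  exist _ _ (nu_src_tgt_subproof n a x).

Definition nu_ocomp n (x y z : nu_car) : Prop :=
  nu_src_tgt n true x = nu_src_tgt n false y /\
  forall q a,
    sval z q a = sval x q a - sval (nu_src_tgt n true x) q a + sval y q a.


Lemma nu_eq (x y : nu_car) : (forall q a, sval x q a = sval y q a) -> x = y.
Proof.
case: x y => [x ?] [y ?] /= xy; apply: eq_exist.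
by apply: functional_extensionality_dep => q; apply: funext => a.
Qed.

Definition nu_composable n (x y : nu_car) : Prop :=
  (forall q b, (q < n)%N -> sval x q b = sval y q b) /\
  sval x n true = sval y n false.

Lemma nu_composableP n (x y : nu_car) :
  nu_src_tgt n true x = nu_src_tgt n false y <-> nu_composable n x y.
Proof.
split=> [e|[lo mid]].
  have {}e q b : nu_src_tgt_seq n true (sval x) q b =
      nu_src_tgt_seq n false (sval y) q b.
    by move/(congr1 (fun z : nu_car => sval z q b)): e.
  split=> [q b qn|]; first by move: (e q b); rewrite /nu_src_tgt_seq qn.
  by move: (e n true); rewrite /nu_src_tgt_seq ltnn eqxx.
apply: nu_eq => q b /=; rewrite /nu_src_tgt_seq.
by case: (ltngtP q n) => [/lo ->|//|->].
Qed.

Definition nu_comp_seq n (x y : double_sequence) : double_sequence :=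
  fun q b => if (q < n)%N then x q b
             else if q == n then (if b then y q true else x q false)
             else x q b + y q b.

Lemma nu_ocompP n (x y z : nu_car) :
  nu_ocomp n x y z <->
  nu_composable n x y /\
  forall q b, sval z q b = nu_comp_seq n (sval x) (sval y) q b.
Proof.
split=> -[].
  move=> /[dup] /nu_composableP[lo mid] e zE; split=> // q b.
  rewrite zE /= /nu_src_tgt_seq /nu_comp_seq.
  case: (ltngtP q n) => [qn|nq|->].
  - by rewrite -(lo q b qn) subrr add0r.
  - by rewrite subr0.
  - by case: b; rewrite ?mid ?subrr ?add0r// subrK.
move=> /[dup] /nu_composableP e [lo mid] zE; split=> // q b.
rewrite zE /= /nu_src_tgt_seq /nu_comp_seq.
case: (ltngtP q n) => [qn|nq|->].
- by rewrite -(lo q b qn) subrr add0r.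
- by rewrite subr0.
- by case: b; rewrite ?mid ?subrr ?add0r// subrK.
Qed.

Lemma nu_comp_subproof n (x y : nu_car) :
  nu_composable n x y -> in_nu (nu_comp_seq n (sval x) (sval y)).
Proof.
case: x y => [x [xp [N xf] xa xb]] [y [yp [M yf] ya yb]] [/= lo mid].
rewrite /nu_comp_seq; split.
- by move=> q [|]; case: ltngtP => // _; exact: positiveD.
- exists (maxn n.+1 (maxn N M)) => q b.
  rewrite !geq_max => /and3P[nq Nq Mq].
  by rewrite ltnNge (ltnW nq) gtn_eqF //= xf // yf // addr0.
- by move=> [|]; case: ltngtP.
- move=> q b; case: (ltngtP q n) => [qn|nq|qn].
  + case: (ltngtP q.+1 n) => [_|nq|qn1]; first exact: xb.
      by move: nq; rewrite ltnS leqNgt qn.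
    by case: b; rewrite -?yb -?xb ?(lo q).
  + rewrite ltnNge (leqW (ltnW nq)) /= gtn_eqF ?(leqW nq)// [RHS]raddfD /=.
    by rewrite -xb -yb opprD addrACA.
  + rewrite -qn in mid *; rewrite ltnNge leqnSn /= gtn_eqF// [RHS]raddfD /=.
    rewrite -xb -yb.
    by rewrite mid [RHS]addrC addrA subrK.
Qed.

Lemma nu_ocomp_fun n (x y z z' : nu_car) :
  nu_ocomp n x y z -> nu_ocomp n x y z' -> z = z'.
Proof. by move=> [_ e] [_ e']; apply: nu_eq => q a; rewrite e e'. Qed.

Lemma nu_ocomp_def n (x y : nu_car) :
  (exists z, nu_ocomp n x y z) <-> nu_src_tgt n true x = nu_src_tgt n false y.
Proof.
split=> [[z []]//|/nu_composableP xy].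
by exists (exist _ _ (nu_comp_subproof xy)); apply/nu_ocompP.
Qed.

Lemma nu_src_tgt_idem n a b (x : nu_car) :
  nu_src_tgt n a (nu_src_tgt n b x) = nu_src_tgt n b x.
Proof.
by apply: nu_eq => q c /=; rewrite /nu_src_tgt_seq; case: ltngtP.
Qed.

Lemma nu_src_ocomp n (x y z : nu_car) :
  nu_ocomp n x y z -> nu_src_tgt n false z = nu_src_tgt n false x.
Proof.
move=> /nu_ocompP[[lo mid] zE]; apply: nu_eq => q b /=.
by rewrite /nu_src_tgt_seq !zE /nu_comp_seq; case: ltngtP.
Qed.

Lemma nu_tgt_ocomp n (x y z : nu_car) :
  nu_ocomp n x y z -> nu_src_tgt n true z = nu_src_tgt n true y.
Proof.
move=> /nu_ocompP[[lo mid] zE]; apply: nu_eq => q b /=.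
rewrite /nu_src_tgt_seq !zE /nu_comp_seq; case: ltngtP => // qn.
exact: lo.
Qed.

Lemma nu_ocomp_idl n (x : nu_car) : nu_ocomp n (nu_src_tgt n false x) x x.
Proof.
apply/nu_ocompP; split.
  split=> [q b qn|] /=; rewrite /nu_src_tgt_seq ?qn//.
  by rewrite ltnn eqxx.
move=> q b /=; rewrite /nu_comp_seq /nu_src_tgt_seq.
by case: ltngtP => // _; [rewrite add0r|case: b].
Qed.

Lemma nu_ocomp_idr n (x : nu_car) : nu_ocomp n x (nu_src_tgt n true x) x.
Proof.
apply/nu_ocompP; split.
  split=> [q b qn|] /=; rewrite /nu_src_tgt_seq ?qn//.
  by rewrite ltnn eqxx.
move=> q b /=; rewrite /nu_comp_seq /nu_src_tgt_seq.
by case: ltngtP => // _; [rewrite addr0|case: b].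
Qed.

Lemma nu_ocompA n (x y z u v w : nu_car) :
  nu_ocomp n x y u -> nu_ocomp n y z v -> nu_ocomp n u z w ->
  nu_ocomp n x v w.
Proof.
move=> /nu_ocompP[[xy xy'] uE] /nu_ocompP[[yz yz'] vE] /nu_ocompP[_ wE].
apply/nu_ocompP; split.
  split=> [q b qn|]; rewrite vE /nu_comp_seq.
    by rewrite qn xy.
  by rewrite ltnn eqxx.
move=> q b; rewrite wE /nu_comp_seq !uE !vE /nu_comp_seq.
by case: ltngtP => // _; rewrite addrA.
Qed.

Lemma nu_src_tgt_low m n a b (x : nu_car) : (m < n)%N ->
  nu_src_tgt m b (nu_src_tgt n a x) = nu_src_tgt m b x /\
  nu_src_tgt n a (nu_src_tgt m b x) = nu_src_tgt m b x.
Proof.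
move=> mn; split; apply: nu_eq => q c /=; rewrite /nu_src_tgt_seq.
  case: (ltngtP q m) => [qm|//|->]; last by rewrite mn.
  by rewrite (ltn_trans qm mn).
case: (ltngtP q n) => // [nq|->].
  by rewrite ltnNge (ltnW (ltn_trans mn nq)) /= gtn_eqF// (ltn_trans mn nq).
by rewrite ltnNge (ltnW mn) /= gtn_eqF.
Qed.

Lemma nu_src_tgt_comm m n a b (x : nu_car) : m <> n ->
  nu_src_tgt m a (nu_src_tgt n b x) = nu_src_tgt n b (nu_src_tgt m a x).
Proof.
move=> /eqP; rewrite neq_ltn => /orP[] mn.
  by rewrite !(nu_src_tgt_low _ _ _ mn).1 (nu_src_tgt_low _ _ _ mn).2.
by rewrite (nu_src_tgt_low _ _ _ mn).1 (nu_src_tgt_low _ _ _ mn).2.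
Qed.

Lemma nu_src_tgt_ocomp m n a (x y z : nu_car) : m <> n ->
  nu_ocomp n x y z ->
  nu_ocomp n (nu_src_tgt m a x) (nu_src_tgt m a y) (nu_src_tgt m a z).
Proof.
move=> mn /nu_ocompP[[xy xy'] zE]; apply/nu_ocompP; split.
  split=> [q b qn|] /=; rewrite /nu_src_tgt_seq.
    by rewrite !(xy q).
  by case: (ltngtP n m) => // nm; case: mn.
move=> q b /=; rewrite /nu_comp_seq /nu_src_tgt_seq !zE /nu_comp_seq.
case: (ltngtP q m) => [//|_|qm]; last first.
  by rewrite qm; case: (ltngtP m n) => // e; case: mn.
by rewrite addr0 !if_same.
Qed.

Lemma nu_interchange m n (x y z w xy zw xz yw : nu_car) : m <> n ->
  nu_ocomp m x y xy -> nu_ocomp m z w zw ->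
  nu_ocomp n x z xz -> nu_ocomp n y w yw ->
  exists2 t, nu_ocomp n xy zw t & nu_ocomp m xz yw t.
Proof.
move=> mn /nu_ocompP[[c1 c1'] e1] /nu_ocompP[[c2 c2'] e2].
move=> /nu_ocompP[[c3 c3'] e3] /nu_ocompP[[c4 c4'] e4].
have cxy : nu_composable n xy zw.
  split=> [q b qn|]; rewrite e1 e2 /nu_comp_seq.
    by rewrite !(c3 q)// !(c4 q).
  by rewrite c3' c4'; case: (ltngtP n m) => // e; case: mn.
exists (exist _ _ (nu_comp_subproof cxy)); apply/nu_ocompP; split=> //.
  split=> [q b qm|]; rewrite e3 e4 /nu_comp_seq.
    by rewrite !(c1 q)// !(c2 q).
  by rewrite c1' c2'; case: (ltngtP m n) => // e; case: mn.
move=> q b /=; rewrite /nu_comp_seq !e1 !e2 !e3 !e4 /nu_comp_seq.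
case: (ltngtP q n) => [qn|nq|qn]; case: (ltngtP q m) => [qm|mq|qm] //.
- by rewrite addrACA.
- by case: b.
- by case: b.
Qed.

Lemma nu_ocat_finite (x : nu_car) : exists m, nu_src_tgt m false x = x.
Proof.
case: x => x [xp [N xf] xa xb]; exists N; apply: nu_eq => q b /=.
rewrite /nu_src_tgt_seq; case: ltngtP => // [Nq|->].
  by rewrite xf// ltnW.
by rewrite !xf.
Qed.

Definition nu_obj : omega_category :=
  OmegaCategory nu_ocomp_fun nu_ocomp_def nu_src_tgt_idem nu_src_ocomp
    nu_tgt_ocomp nu_ocomp_idl nu_ocomp_idr nu_ocompA nu_src_tgt_comm
    nu_src_tgt_ocomp nu_interchange nu_src_tgt_low nu_ocat_finite.

End Nu.

Section NuMap.
Variables (K L : adc) (f : adc_hom K L).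

Lemma nu_map_subproof (x : nu_car K) :
  in_nu (fun q a => sval f q (sval x q a)).
Proof.
case: f x => [g [g1 g2 g3 g4]] [x [xp [N xf] xa xb]]; split=> /=.
- by move=> q a; exact/g4/xp.
- exists N => q a Nq; rewrite xf//.
  by rewrite -(subrr (0 : K q)) g1 subrr.
- by move=> a; rewrite g3.
- by move=> q a; rewrite -g1 (xb q a) g2.
Qed.

Definition nu_map (x : nu_obj K) : nu_obj L := exist _ _ (nu_map_subproof x).

Lemma nu_map_morphism : omega_morphism nu_map.
Proof.
have f1 q x y : sval f q (x - y) = sval f q x - sval f q y.
  by case: (svalP f) => + _ _ _; exact.
have f0 q : sval f q 0 = 0 by rewrite -(subrr (0 : K q)) f1 subrr.
have map_d n a x : nu_map (src_tgt n a x) = src_tgt n a (nu_map x).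
  apply: nu_eq => q b /=; rewrite /nu_src_tgt_seq.
  by case: ltngtP => // _; exact: f0.
split=> [//|n x y z [xy zE]]; split.
  exact: etrans (esym (map_d _ _ _)) (etrans (congr1 nu_map xy) (map_d _ _ _)).
move=> q b; have -> : sval (nu_map z) q b = sval f q (sval z q b) by [].
have fD u v : sval f q (u + v) = sval f q u + sval f q v.
  by rewrite -{1}(opprK v) f1 -(sub0r v) f1 f0 sub0r opprK.
rewrite zE fD f1 -[nu_src_tgt n true (nu_map x)]/(src_tgt n true (nu_map x)).
by rewrite -map_d.
Qed.

End NuMap.

Program Definition nu : functor ADC OmegaCat :=
  @Functor ADC OmegaCat nu_obj
    (fun K L f => exist _ (@nu_map K L f) (nu_map_morphism f)) _ _.
Next Obligation.
by move=> K /=; apply: eq_exist; apply: funext => x; exact: nu_eq.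
Qed.
Next Obligation.
by move=> J K L g f /=; apply: eq_exist; apply: funext => x; exact: nu_eq.
Qed.

Definition nu_simple : functor SimpleADC OmegaCat := restriction nu simple_adc.

(* Main.v *)
From HB Require Import structures.
From Stdlib Require Import Relation_Operators Operators_Properties.
From mathcomp Require Import all_boot all_order all_algebra.
From mathcomp Require Import boolp.
From mathcomp Require Import freeg.
From mathcomp Require Import zify.
Require Import Defs.

Set Implicit Arguments.
Unset Strict Implicit.
Unset Printing Implicit Defensive.

Import GRing.Theory Num.Theory Order.TTheory.
Local Open Scope ring_scope.

(** Let X be a simple globular set and A the complex that it generates.  The
    theorem follows from the fact that nu A is the free omega-category on X, a
    cell c being sent to its atom: the double sequence of the iterated faces of
    c ([nu_free]).

    Indeed, every omega-morphism g from nu A to nu L comes from the chain map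
    that sends a q-cell e to the component of dimension q of g (atom e): the
    faces of g (atom e) are the images of the faces of e, and the equation
    between successive components in nu L says that this map commutes with the
    boundary.  It induces g because both agree on the atoms
    ([nu_chain_hom]).  So nu is fully faithful on simple complexes.  Two free
    omega-categories on the same globular set are isomorphic, hence nu takes
    simple complexes to simple omega-categories and reaches all of them up to
    isomorphism.  As nu is full there, its image is a full subcategory, and the
    inclusion of this image in Theta is an equivalence.

    Freeness rests on the total order of X.  The target of a cell x of positive
    dimension is the first cell after x whose dimension is smaller than that of
    x, and its source is the last such cell before x
    ([lower_dim_beyond_face]); an injective numbering of the cells with these
    properties is a ranking.  Since ranks increase strictly from the source to
    the target of a cell, positive chains behave like paths: one whose boundary
    is supported between two ranks is itself supported between them
    ([support_between]).

    Call an element of nu A m-narrow if its components in dimensions at most m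
    are single cells; every element is 0-narrow.  An m-narrow z whose two ends
    z_m^- = a and z_m^+ = b coincide is the atom of a.  Otherwise let c be the
    first m-cell after a.  Restricting z to the cells before c and to the
    cells after c gives z = x #_m y, where x is (m+1)-narrow with x_m^+ = c, and
    y is m-narrow with fewer cells between its ends; moreover this is the only
    way to write z as x #_m y with such x and y ([narrow_decomp_unique]).
    Iterating the decomposition yields a normal form of z as a composite of
    atoms.  Given a family j of elements of an omega-category D satisfying the
    globular relations, [eval] evaluates these normal forms in D.  The
    evaluation is single-valued because the decomposition is unique, it is total
    by induction on the number of ranks between the ends, and it preserves #_n
    by associativity when n is the current level m, and by the interchange law
    when n > m ([eval_ocomp]). *)

(** * Fully faithful functors and equivalences of categories *)

Section Categories.

Lemma full_faithful_reflects_iso (C D : category) (F : functor C D) :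
  full F -> faithful F ->
  forall a b : C, isomorphic (F a) (F b) -> isomorphic a b.
Proof.
move=> Ffull Ffaith a b [f [g [gf fg]]].
have [f' ef] := Ffull _ _ f; have [g' eg] := Ffull _ _ g.
exists f', g'; split; apply: Ffaith; rewrite /= fmap_comp fmap_id ef eg //.
Qed.

Lemma isomorphic_sym (C : category) (a b : C) :
  isomorphic a b -> isomorphic b a.
Proof. by move=> [f [g [gf fg]]]; exists g, f. Qed.

Lemma functor_isomorphic (C D : category) (F : functor C D) (a b : C) :
  isomorphic a b -> isomorphic (F a) (F b).
Proof.
move=> [f [g [gf fg]]]; exists (fmap F f), (fmap F g).
by rewrite -!fmap_comp gf fg !fmap_id.
Qed.

Lemma full_faithful_esssurj_equivalence (C D : category) (F : functor C D) :
  full F -> faithful F -> (forall d : D, exists c : C, isomorphic (F c) d) ->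
  equivalent_categories C D.
Proof.
move=> Ffull Ffaith Fsurj.
pose pre a b (g : hom (F a) (F b)) : hom a b := sval (cid (Ffull _ _ g)).
have preK a b (g : hom (F a) (F b)) : fmap F (pre a b g) = g.
  by rewrite /pre; case: cid.
pose G0 d := sval (cid (Fsurj d)).
have isoG d : {u : hom (F (G0 d)) d & {v : hom d (F (G0 d)) |
    ccomp v u = idm _ /\ ccomp u v = idm _}}.
  rewrite /G0; case: cid => c iso; have [u iu] := cid iso.
  by have [v ?] := cid iu; exists u, v.
pose u d := projT1 (isoG d); pose v d := sval (projT2 (isoG d)).
have vu d : ccomp (v d) (u d) = idm _ by case: (svalP (projT2 (isoG d))).
have uv d : ccomp (u d) (v d) = idm _ by case: (svalP (projT2 (isoG d))).
pose G1 d e (f : hom d e) : hom (G0 d) (G0 e) :=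
  pre _ _ (ccomp (v e) (ccomp f (u d))).
have G1id d : G1 d d (idm d) = idm _.
  by apply: Ffaith; rewrite /= preK fmap_id ccomp_idl vu.
have G1comp a b c (g : hom b c) (f : hom a b) :
    G1 _ _ (ccomp g f) = ccomp (G1 _ _ g) (G1 _ _ f).
  apply: Ffaith; rewrite /= fmap_comp !preK -!ccompA; congr ccomp.
  by rewrite [ccomp (u b) _]ccompA uv ccomp_idl.
exists F, (Functor G1id G1comp); split.
  exists (fun a => pre _ _ (u (F a))); split=> [a|a b f] /=.
    exists (pre _ _ (v (F a))); split; apply: Ffaith;
      by rewrite /= fmap_comp fmap_id !preK ?vu ?uv.
  by apply: Ffaith; rewrite /= !fmap_comp !preK ccompA uv ccomp_idl.
exists u; split=> [a|a b f] /=; first by exists (v a).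
by rewrite preK ccompA uv ccomp_idl.
Qed.

(** Destructing the two equalities turns f into a morphism between values of F,
    where fullness applies; so the image of a full functor is a full
    subcategory. *)
Lemma image_mor_of_full (C D : category) (F : functor C D)
    (a b : D) (f : hom a b) :
  full F -> (exists x, F x = a) -> (exists x, F x = b) -> image_mor F f.
Proof.
move=> Ffull [x ex] [y ey]; subst a b.
by have [g <-] := Ffull _ _ f; exact: image_fmap.
Qed.

Lemma image_equivalent_full_subcategory (C D : category) (F : functor C D)
    (P : D -> Prop) :
  full F -> (forall x, P (F x)) ->
  (forall d, P d -> exists x, isomorphic (F x) d) ->
  equivalent_categories (image F) (full_subcategory P).
Proof.
move=> Ffull FP Psurj.
have FP' (a : image F) : P (sval a) by case: a => a /= [x <-].
pose I : functor (image F) (full_subcategory P) :=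
  @Functor (image F) (full_subcategory P) (fun a => exist _ (sval a) (FP' a))
    (fun a b f => sval f) (fun a => erefl) (fun _ _ _ _ _ => erefl).
apply: (@full_faithful_esssurj_equivalence _ _ I).
- move=> a b g.
  by exists (exist _ g (@image_mor_of_full _ _ F _ _ g Ffull (svalP a) (svalP b))).
- by move=> a b [f ?] [g ?] /= fg; exact: eq_exist.
- move=> [d Pd]; have [x [f iso]] := Psurj d Pd.
  by exists (exist _ (F x) (ex_intro _ x erefl)); exists f.
Qed.

End Categories.

(** * The total order of a simple globular set *)

Section Globular.
Variable X : globular_set.
Implicit Types (x y z : X) (a b : bool).

Lemma gface_gface a b x : (2 <= gdim x)%N ->
  gface b (gface a x) = gface b (gface b x).
Proof. by case: a b => [] [] // /gface_face ->. Qed.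

Lemma gdim_iter_face a k x : (k <= gdim x)%N ->
  gdim (iter k (gface a) x) = (gdim x - k)%N.
Proof.
elim: k => [|k IHk] kx /=; first by rewrite subn0.
by rewrite gdim_face IHk ?subnS// ?subn_gt0// ltnW.
Qed.

(** Globularity: only the sign of the last face matters. *)
Lemma gface_iter_face a b k x : (k < gdim x)%N ->
  gface b (iter k (gface a) x) = iter k.+1 (gface b) x.
Proof.
elim: k => [//|k IHk] kx; rewrite iterS gface_gface; last first.
  by rewrite gdim_iter_face; lia.
by rewrite IHk// ltnW.
Qed.

(** Reversing the order exchanges sources and targets, so that one proof serves
    for both signs. *)
Definition signed_step a x y := if a then glob_step x y else glob_step y x.

Lemma signed_stepP a x y : signed_step a x y ->
  (0 < gdim x)%N /\ y = gface a x \/ (0 < gdim y)%N /\ x = gface (~~ a) y.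
Proof. by case: a => -[] z z0; [right|left|left|right]. Qed.

(** Along a path of steps that stays in dimensions at least n, the iterated face
    of dimension n - 1 and sign a does not change; and the path can only leave
    these dimensions through that face. *)
Lemma path_meets_iter_face a n x y : (0 < n)%N ->
  clos_trans_1n X (signed_step a) x y -> forall k, gdim x = (n + k)%N ->
  (gdim y < n)%N ->
  iter k.+1 (gface a) x = y \/
  clos_trans_1n X (signed_step a) (iter k.+1 (gface a) x) y.
Proof.
move=> n0; elim=> {x y} [x y /signed_stepP[][d0 ->]|
                         x z y /signed_stepP[][d0 ->] zy IH] k xk yn.
- left; have -> : k = 0%N by move: yn; rewrite gdim_face; lia.
  by [].
- by move: xk; rewrite gdim_face; lia.
- case: k xk => [|k] xk; first by right.
  by rewrite iterSr; apply: IH => //; rewrite gdim_face; lia.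
- move: xk; rewrite gdim_face// => xk.
  rewrite iterSr gface_gface; last by lia.
  by rewrite -!iterSr; apply: IH => //; lia.
Qed.

Definition signed_lt a x y := if a then glob_lt x y else glob_lt y x.

Lemma signed_ltE a x y :
  signed_lt a x y <-> clos_trans_1n X (signed_step a) x y.
Proof.
rewrite -clos_trans_t1n_iff; case: a => //.
by split=> /=; elim=> [u v uv|u v w _ uv _ vw];
  [exact: t_step | exact: t_trans vw uv | exact: t_step | exact: t_trans vw uv].
Qed.

Lemma lower_dim_beyond_face a x y : signed_lt a x y -> (gdim y < gdim x)%N ->
  gface a x = y \/ signed_lt a (gface a x) y.
Proof.
rewrite !signed_ltE => xy yx.
by apply: (@path_meets_iter_face a (gdim x) x y _ xy 0); lia.
Qed.

(** The order is recorded by numbers, so that integer-valued functionals on chains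
    can be built from it. *)
Record ranking (r : X -> nat) : Prop := Ranking {
  rank_inj : injective r;
  rank_src : forall x, (0 < gdim x)%N -> (r (gface false x) < r x)%N;
  rank_tgt : forall x, (0 < gdim x)%N -> (r x < r (gface true x))%N;
  rank_src_dim : forall x y, (0 < gdim x)%N ->
    (r (gface false x) < r y < r x)%N -> (gdim x <= gdim y)%N;
  rank_tgt_dim : forall x y, (0 < gdim x)%N ->
    (r x < r y < r (gface true x))%N -> (gdim x <= gdim y)%N
}.

(** The rank of x is the number of cells that precede it. *)
Lemma simple_ranking : simple_globular_set X -> exists r, ranking r.
Proof.
move=> [_ [s sX] [irr tr tot]].
pose r x := count (fun y => `[< glob_lt y x >]) (undup s).
have mono x y : glob_lt x y -> (r x < r y)%N.
  move=> xy; rewrite /r -!size_filter.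
  rewrite -[_.+1]/(size (x :: [seq z <- undup s | `[< glob_lt z x >]])).
  apply: uniq_leq_size => [/=|z].
    by rewrite mem_filter filter_uniq ?undup_uniq// andbT; case: asboolP => // /irr.
  rewrite inE !mem_filter mem_undup sX !andbT => /orP[/eqP->|/asboolP zx].
    exact/asboolP.
  by apply/asboolP; exact: tr xy.
have lt_of_r x y : (r x < r y)%N -> glob_lt x y.
  by case: (tot x y) => [//|->|/mono]; rewrite ?ltnn// => /ltnW; rewrite leqNgt => /negP.
exists r; split.
- by move=> x y rxy; case: (tot x y) => [/mono|//|/mono]; rewrite rxy ltnn.
- by move=> x x0; apply/mono/t_step/glob_step_src.
- by move=> x x0; apply/mono/t_step/glob_step_tgt.
- move=> x y x0 /andP[/lt_of_r xy /lt_of_r yx]; rewrite leqNgt; apply/negP.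
  move=> /(@lower_dim_beyond_face false x y yx)[e|/= lt].
    by move: xy; rewrite e => /irr.
  exact: irr (tr _ _ _ xy lt).
- move=> x y x0 /andP[/lt_of_r xy /lt_of_r yx]; rewrite leqNgt; apply/negP.
  move=> /(@lower_dim_beyond_face true x y xy)[e|/= lt].
    by move: yx; rewrite e => /irr.
  exact: irr (tr _ _ _ yx lt).
Qed.

End Globular.

(** * Positive chains in free abelian groups *)

Section FreeAbelianGroup.
Variable T : choiceType.
Implicit Types (D : {freeg T}) (x y : T) (h : T -> int) (P : pred T).

Definition positive_chain D :=
  generated_submonoid (fun D => exists x, D = << x >>) D.

Lemma freeg_additive_ext (V : zmodType) (f g : {additive {freeg T} -> V}) :
  (forall x, f << x >> = g << x >>) -> forall D, f D = g D.
Proof.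
move=> fg D; apply/eqP; rewrite -subr_eq0; apply/eqP.
rewrite -[LHS]/((f \- g) D); apply: freeg_additive0 => x /=.
by rewrite fg subrr.
Qed.

Definition weight h D : int := fglift (fun x => h x : int^o) D.

Lemma weight_is_zmod_morphism h : zmod_morphism (weight h).
Proof. exact: (@lift_is_additive _ _ int^o). Qed.

HB.instance Definition _ h :=
  GRing.isZmodMorphism.Build {freeg T} int (weight h)
    (weight_is_zmod_morphism h).

Lemma weightU h x : weight h << x >> = h x.
Proof. by rewrite /weight liftU scale1r. Qed.

Lemma weightE h D : weight h D = \sum_(x <- dom D) coeff x D * h x.
Proof.
rewrite -[in LHS](freeg_sumE D) raddf_sum; apply: eq_bigr => x _ /=.
by rewrite /weight liftU.
Qed.

Lemma eq_in_weight h1 h2 D :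
  (forall x, coeff x D != 0 -> h1 x = h2 x) -> weight h1 D = weight h2 D.
Proof.
move=> h12; rewrite !weightE; apply: eq_big_seq => x.
by rewrite mem_dom => /h12 ->.
Qed.

Lemma weight_const0 D : weight (fun=> 0) D = 0.
Proof. by rewrite weightE big1 // => x _; rewrite mulr0. Qed.

Lemma coeff_weight y D : coeff y D = weight (fun x => (x == y)%:R) D.
Proof. by []. Qed.

Lemma deg_weight D : deg D = weight (fun=> 1) D.
Proof. by []. Qed.

Lemma positive_coeff_ge0 D x : positive_chain D -> 0 <= coeff x D.
Proof.
elim=> [_ [y ->]||D1 D2 _ IH1 _ IH2]; rewrite ?coeffU ?coeff0 ?coeffD ?mul1r//.
exact: addr_ge0.
Qed.

Lemma weight_ge0 h D : positive_chain D -> (forall x, 0 <= h x) ->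
  0 <= weight h D.
Proof.
move=> Dpos h0; rewrite weightE sumr_ge0// => x _.
by rewrite mulr_ge0// positive_coeff_ge0.
Qed.

(** A vanishing sum of nonnegative terms; this is how functionals bound the
    support of a positive chain. *)
Lemma weight_eq0_support h D x : positive_chain D -> (forall x, 0 <= h x) ->
  weight h D = 0 -> coeff x D != 0 -> h x = 0.
Proof.
move=> Dpos h0 D0 xD; move: D0; rewrite weightE => /eqP.
rewrite psumr_eq0; last first.
  by move=> y _; rewrite mulr_ge0// positive_coeff_ge0.
move=> /allP/(_ x); rewrite mem_dom => /(_ xD).
by rewrite /= mulf_eq0 (negPf xD) => /eqP.
Qed.

Lemma freeg_eq0 D : (forall x, coeff x D = 0) -> D = 0.
Proof. by move=> D0; apply/eqP/freeg_eqP => x; rewrite D0 coeff0. Qed.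

Lemma freeg_eq0_off D x : (forall y, y != x -> coeff y D = 0) -> deg D = 0 ->
  D = 0.
Proof.
move=> Dy; rewrite deg_weight.
rewrite (@eq_in_weight _ (fun y => (y == x)%:R)) -?coeff_weight => [Dx|y].
  by apply: freeg_eq0 => y; case: (eqVneq y x) => [->|/Dy].
by case: (eqVneq y x) => // /Dy ->; rewrite eqxx.
Qed.

Lemma positive_deg0 D : positive_chain D -> deg D = 0 -> D = 0.
Proof.
move=> Dpos D0; apply: freeg_eq0 => x; apply/eqP; apply: contraT => xD.
have /eqP := weight_eq0_support (h := fun=> 1) Dpos (fun=> ler01) D0 xD.
by rewrite oner_eq0.
Qed.

(** Split off one generator: the remainder is positive of degree 0. *)
Lemma positive_deg1 D : positive_chain D -> deg D = 1 -> exists x, D = << x >>.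
Proof.
move=> Dpos D1.
have [D0|[x [D' D'pos DE]]] : D = 0 \/
    exists x, exists2 D', positive_chain D' & D = << x >> + D'.
- elim: Dpos {D1} => [_ [x ->]||D1 D2 D1pos [->|[x [D' D'pos ->]]] D2pos IH2].
  + by right; exists x, 0; [exact: gen_zero | rewrite addr0].
  + by left.
  + by rewrite add0r.
  + by right; exists x, (D' + D2); [exact: gen_add | rewrite addrA].
- by move: D1; rewrite D0 raddf0.
exists x; rewrite DE (positive_deg0 D'pos) ?addr0//.
by move: D1; rewrite DE raddfD /= degU; lia.
Qed.

Lemma freegU_inj x y : << x >> = << y >> :> {freeg T} -> x = y.
Proof.
move/(congr1 (coeff x)); rewrite !coeffU !mul1r eqxx.
by case: eqVneq.
Qed.

Lemma freegUB_inj x y x' y' : x' != y' ->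
  << x >> - << y >> = << x' >> - << y' >> :> {freeg T} -> x = x' /\ y = y'.
Proof.
move=> xy' e; have xx' : x = x'.
  move/(congr1 (coeff x')): e; rewrite !coeffB !coeffU !mul1r eqxx.
  by rewrite (eq_sym y') (negPf xy'); case: (eqVneq x x') => // _; case: eqVneq.
by split=> //; apply: freegU_inj; move: e; rewrite xx' => /addrI/oppr_inj.
Qed.

Definition extend (V : zmodType) (h : T -> V) D : V :=
  fglift (fun x => h x : zmodule V) D.

Lemma extend_is_zmod_morphism (V : zmodType) (h : T -> V) : zmod_morphism (@extend V h).
Proof. exact: (@lift_is_additive _ _ (zmodule V)). Qed.

HB.instance Definition _ (V : zmodType) (h : T -> V) :=
  GRing.isZmodMorphism.Build {freeg T} V (@extend V h)
    (extend_is_zmod_morphism h).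

Lemma extendU (V : zmodType) (h : T -> V) x : @extend V h << x >> = h x.
Proof. by rewrite /extend liftU scale1r. Qed.

Definition restrict P D : {freeg T} :=
  extend (fun x => if P x then << x >> else 0) D.

HB.instance Definition _ P :=
  GRing.isZmodMorphism.Build {freeg T} {freeg T} (restrict P)
    (extend_is_zmod_morphism _).

Lemma restrictU P x : restrict P << x >> = if P x then << x >> else 0.
Proof. exact: extendU. Qed.

Lemma weight_restrict P h D :
  weight h (restrict P D) = weight (fun x => if P x then h x else 0) D.
Proof.
apply: (freeg_additive_ext (f := weight h \o restrict P)) => x /=.
by rewrite restrictU weightU; case: ifP => _; rewrite ?weightU ?raddf0.
Qed.

Lemma coeff_restrict P x D :
  coeff x (restrict P D) = if P x then coeff x D else 0.
Proof.
rewrite !coeff_weight weight_restrict.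
case Px: (P x); last rewrite -[RHS](weight_const0 D).
  by apply: eq_in_weight => y _; case: (eqVneq y x) => [->|_]; rewrite ?Px ?if_same.
by apply: eq_in_weight => y _; case: (eqVneq y x) => [->|_]; rewrite ?Px ?if_same.
Qed.

Lemma restrict_positive P D : positive_chain D -> positive_chain (restrict P D).
Proof.
elim=> [_ [x ->]||D1 D2 _ pos1 _ pos2].
- by rewrite restrictU; case: ifP => _; [apply: gen_base; exists x | exact: gen_zero].
- by rewrite raddf0; exact: gen_zero.
- by rewrite raddfD; exact: gen_add.
Qed.

Lemma restrict_id P D : (forall x, coeff x D != 0 -> P x) -> restrict P D = D.
Proof.
move=> DP; apply/eqP/freeg_eqP => x; rewrite coeff_restrict.
by case: ifP => // /negP Px; apply/esym/eqP; apply: contraT => /DP.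
Qed.

Lemma restrict_eq0 P D : (forall x, coeff x D != 0 -> ~~ P x) -> restrict P D = 0.
Proof.
move=> DP; apply: freeg_eq0 => x; rewrite coeff_restrict.
by case: ifP => // Px; apply/eqP; apply: contraT => /DP; rewrite Px.
Qed.

Lemma restrictC P D : restrict P D + restrict (predC P) D = D.
Proof.
apply/eqP/freeg_eqP => x; rewrite coeffD !coeff_restrict /=.
by case: (P x); rewrite ?addr0 ?add0r.
Qed.

End FreeAbelianGroup.

(** * Boundaries in a ranked globular set *)

(** Adjunction between boundary and coboundary: functionals that increase along
    cells become nonnegative, which makes [weight_eq0_support] applicable. *)
Lemma weight_bd (X : globular_set) q (h : gcell X q -> int)
    (w : {freeg (gcell X q.+1)}) :
  weight h (gen_bd_fun w) =
  weight (fun e => h (gcell_face true e) - h (gcell_face false e)) w.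
Proof.
apply: (freeg_additive_ext (f := weight h \o @gen_bd_fun X q)) => e /=.
by rewrite gen_bdU raddfB /= !weightU.
Qed.

Lemma deg_bd (X : globular_set) q (w : {freeg (gcell X q.+1)}) :
  deg (gen_bd_fun w) = 0.
Proof. by rewrite deg_weight weight_bd subrr weight_const0. Qed.

Section Ranked.
Variables (X : globular_set) (r : X -> nat).
Hypothesis rX : ranking r.

Definition rank q (e : gcell X q) : nat := r (val e).

Lemma rank_cell_inj q : injective (@rank q).
Proof. by move=> x y /(rank_inj rX)/val_inj. Qed.

Lemma gdim_cell q (e : gcell X q) : gdim (val e) = q.
Proof. exact/eqP/(valP e). Qed.

Lemma rank_cell_src q (e : gcell X q.+1) : (rank (gcell_face false e) < rank e)%N.
Proof. by apply: (rank_src rX); rewrite gdim_cell. Qed.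

Lemma rank_cell_tgt q (e : gcell X q.+1) : (rank e < rank (gcell_face true e))%N.
Proof. by apply: (rank_tgt rX); rewrite gdim_cell. Qed.

Lemma rank_cell_face q (e : gcell X q.+1) :
  (rank (gcell_face false e) < rank (gcell_face true e))%N.
Proof. exact: ltn_trans (rank_cell_src e) (rank_cell_tgt e). Qed.

(** A cell of dimension at most q cannot separate a (q+1)-cell from its faces;
    this is what makes cutting along such a cell compatible with boundaries. *)
Lemma rank_tgt_le q (e : gcell X q.+1) (c : X) : (gdim c <= q)%N ->
  (rank e < r c)%N -> (rank (gcell_face true e) <= r c)%N.
Proof.
move=> cq ec; rewrite leqNgt; apply/negP => cf.
have := @rank_tgt_dim _ _ rX (val e) c.
by rewrite [r _]/(rank e) ec cf gdim_cell => /(_ isT isT); lia.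
Qed.

Lemma rank_src_ge q (e : gcell X q.+1) (c : X) : (gdim c <= q)%N ->
  (r c < rank e)%N -> (r c <= rank (gcell_face false e))%N.
Proof.
move=> cq ec; rewrite leqNgt; apply/negP => cf.
have := @rank_src_dim _ _ rX (val e) c.
by rewrite [r (val _)]/(rank e) ec andbT cf gdim_cell => /(_ isT isT); lia.
Qed.

Lemma rank_neq q (e : gcell X q) (c : X) : gdim c != q -> rank e != r c.
Proof.
by apply: contra => /eqP/(rank_inj rX) <-; rewrite gdim_cell.
Qed.

(** The functional h vanishes on the ranks between lo and hi, never decreases from
    the source to the target of a cell, and increases strictly as soon as a face
    lies outside this range. *)
Lemma support_between q (w : {freeg (gcell X q.+1)}) lo hi :
  positive_chain w ->
  (forall f, coeff f (gen_bd_fun w) != 0 -> (lo <= rank f <= hi)%N) ->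
  forall e, coeff e w != 0 ->
    (lo <= rank (gcell_face false e))%N /\ (rank (gcell_face true e) <= hi)%N.
Proof.
move=> wpos bdw e ew.
pose h (f : gcell X q) : int :=
  if (rank f < lo)%N then (rank f)%:Z - lo%:Z
  else if (hi < rank f)%N then (rank f)%:Z - hi%:Z else 0.
have hmono e' : 0 <= h (gcell_face true e') - h (gcell_face false e').
  by have lt := rank_cell_face e'; rewrite /h; do 4?case: ltnP => ?; lia.
have h0 : weight h (gen_bd_fun w) = 0.
  rewrite (@eq_in_weight _ _ (fun=> 0)) ?weight_const0// => f /bdw/andP[? ?].
  by rewrite /h; do 2?case: ltnP => ?; lia.
rewrite weight_bd in h0.
have := weight_eq0_support wpos hmono h0 ew; rewrite /h.
by have lt := rank_cell_face e; do 4?case: ltnP => ?; lia.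
Qed.

(** If every cell of w goes from a to c, the coefficient of c in the boundary is
    the degree of w, which is therefore 1. *)
Lemma parallel_single q (w : {freeg (gcell X q.+1)}) a c :
  positive_chain w -> gen_bd_fun w = << c >> - << a >> ->
  (forall e, coeff e w != 0 -> gcell_face false e = a /\ gcell_face true e = c) ->
  a != c -> exists2 e, w = << e >> & gcell_face false e = a /\ gcell_face true e = c.
Proof.
move=> wpos bdw wE ac; have [||e we] := @positive_deg1 _ w => //.
  have : coeff c (gen_bd_fun w) = 1.
    by rewrite bdw coeffB !coeffU eqxx (negPf ac) mulr0 subr0.
  rewrite coeff_weight weight_bd => <-; rewrite deg_weight.
  by apply: eq_in_weight => e /wE[-> ->]; rewrite eqxx (negPf ac) subr0.
by exists e => //; apply: wE; rewrite we coeffU eqxx.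
Qed.

Definition below q (c : X) : pred (gcell X q) := fun e => (rank e < r c)%N.

(** In dimensions above that of c plus one, a cell and its faces lie on the same
    side of c. *)
Lemma restrict_below_bd q (c : X) (w : {freeg (gcell X q.+1)}) :
  (gdim c < q)%N ->
  restrict (@below q c) (gen_bd_fun w) = gen_bd_fun (restrict (@below q.+1 c) w).
Proof.
move=> cq; apply: (freeg_additive_ext
  (f := restrict (@below q c) \o @gen_bd_fun X q)
  (g := @gen_bd_fun X q \o restrict (@below q.+1 c))) => e /=.
have cq0 : gdim c != q by rewrite ltn_eqF.
have := rank_neq e (c := c); rewrite (ltn_eqF (ltnW cq : gdim c < q.+1)%N) => /(_ isT).
have := rank_neq (gcell_face true e) cq0; have := rank_neq (gcell_face false e) cq0.
have := @rank_tgt_le _ e c (ltnW cq); have := @rank_src_ge _ e c (ltnW cq).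
have := rank_cell_src e; have := rank_cell_tgt e.
rewrite gen_bdU raddfB /= !restrictU /below.
case: (ltnP (rank (gcell_face true e)) (r c)) => ft;
  case: (ltnP (rank (gcell_face false e)) (r c)) => fs;
  case: (ltnP (rank e) (r c)) => ee; rewrite ?raddf0 ?subrr ?addr0 ?gen_bdU//; lia.
Qed.

(** Cutting a chain from a to b along a cell c of the dimension of a
    and b.  Cells before c have faces up to c, cells after c have faces from c
    on, so the boundary of the left part agrees with c - a away from c; and
    boundaries have degree 0, which settles the coefficient of c. *)
Lemma bd_restrict_below q (w : {freeg (gcell X q.+1)}) (a b c : gcell X q) :
  gen_bd_fun w = << b >> - << a >> ->
  (rank a < rank c)%N -> (rank c <= rank b)%N ->
  gen_bd_fun (restrict (below (val c)) w) = << c >> - << a >>.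
Proof.
move=> bdw ac cb; apply/eqP; rewrite -subr_eq0; apply/eqP.
apply: (@freeg_eq0_off _ _ c); last first.
  by rewrite !raddfB /= deg_bd !degU !subrr.
move=> f fc; apply/eqP; rewrite coeffB subr_eq0; apply/eqP.
have rfc : rank f != rank c by apply: contra_neq fc => /rank_cell_inj.
have cutle e := @rank_tgt_le _ e (val c); have cutge e := @rank_src_ge _ e (val c).
rewrite gdim_cell in cutle cutge.
have rne (e : gcell X q.+1) : rank e != rank c.
  by apply: rank_neq; rewrite gdim_cell ltn_eqF.
case: (ltnP (rank f) (rank c)) => [fltc|fgec].
  have -> : coeff f (<< c >> - << a >>) = coeff f (<< b >> - << a >>) :> int.
    rewrite !coeffB !coeffU; case: (eqVneq c f) => [cf|_]; first by rewrite cf eqxx in fc.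
    by case: (eqVneq b f) => // bf; rewrite -bf in fltc; lia.
  rewrite -bdw !coeff_weight !weight_bd weight_restrict; apply: eq_in_weight => e _.
  rewrite /below; case: ltnP => // ce.
  have ge : (rank c <= rank (gcell_face false e))%N.
    by apply: cutge; move: (rne e); rewrite /rank in ce *; lia.
  have lt := rank_cell_face e.
  have /negPf -> : gcell_face true e != f by apply: contraTneq fltc => <-; lia.
  have /negPf -> : gcell_face false e != f by apply: contraTneq fltc => <-; lia.
  by rewrite subrr.
rewrite coeff_weight weight_bd weight_restrict coeffB !coeffU.
rewrite [c == f]eq_sym (negPf fc).
have /negPf -> : a != f by apply: contraTneq fgec => <-; lia.
rewrite !mulr0 subrr -[RHS](weight_const0 w); apply: eq_in_weight => e _.
rewrite /below; case: ltnP => // ce.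
have le := cutle _ e (leqnn q) ce; have lt := rank_cell_face e.
have {}fgec : (rank c < rank f)%N by lia.
have /negPf -> : gcell_face true e != f.
  by apply: contraTneq fgec => <-; rewrite -leqNgt.
have /negPf -> : gcell_face false e != f.
  by apply: contraTneq fgec => <-; rewrite -leqNgt (leq_trans (ltnW lt)).
by rewrite subrr.
Qed.

End Ranked.

(** * Omega-categories and atoms *)

Section OmegaLemmas.
Variable D : omega_category.
Implicit Types x y z : D.

Lemma src_tgt_ge n m a b x : (m <= n)%N -> src_tgt m b x = x -> src_tgt n a x = x.
Proof.
rewrite leq_eqVlt => /orP[/eqP->|mn] xm; first by rewrite -xm src_tgt_idem.
by rewrite -xm (src_tgt_low a b x mn).2.
Qed.

Lemma ocomp_exists n x y : src_tgt n true x = src_tgt n false y ->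
  exists z, ocomp n x y z.
Proof. by move/ocomp_def. Qed.

Lemma ocomp_composable n x y z : ocomp n x y z ->
  src_tgt n true x = src_tgt n false y.
Proof. by move=> xyz; apply/ocomp_def; exists z. Qed.

Lemma ocomp_unitl n m x y z : (m <= n)%N -> src_tgt m true x = x ->
  ocomp n x y z -> z = y.
Proof.
move=> mn xm xyz; have := ocomp_composable xyz.
rewrite (src_tgt_ge _ mn xm) => e; move: xyz; rewrite e => xyz.
exact: ocomp_fun xyz (ocomp_idl n y).
Qed.

Lemma ocomp_unitr n m x y z : (m <= n)%N -> src_tgt m true y = y ->
  ocomp n x y z -> z = x.
Proof.
move=> mn ym xyz; have := ocomp_composable xyz.
rewrite (src_tgt_ge _ mn ym) => e; move: xyz; rewrite -e => xyz.
exact: ocomp_fun xyz (ocomp_idr n x).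
Qed.

(** The relations give the faces of codimension 0 and 1; lower faces follow as
    d_n d_k = d_n for n < k. *)
Lemma globular_relations_iter (X : globular_set) (j : X -> D) n a c :
  globular_relations j -> (n <= gdim c)%N ->
  src_tgt n a (j c) = j (iter (gdim c - n) (gface a) c).
Proof.
move=> jrel; move ck: (gdim c - n)%N => k.
elim: k c ck => [|k IHk] c ck nc.
  have -> : n = gdim c by lia.
  exact: (jrel a c).1.
have c0 : (0 < gdim c)%N by lia.
have n1 : (n <= (gdim c).-1)%N by lia.
rewrite iterSr -IHk ?gdim_face//; last by lia.
rewrite -(jrel a c).2//; case: (ltngtP n (gdim c).-1) n1 => // [lt|->] _.
  by rewrite (src_tgt_low a a _ lt).1.
by rewrite src_tgt_idem.
Qed.

End OmegaLemmas.

Section Atoms.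
Variable X : globular_set.
Local Notation A := (adc_of_globular_set X).

(** Making this total, with value 0 on cells of the wrong dimension, avoids
    carrying dimension proofs in the components of an atom. *)
Definition cellchain q (x : X) : {freeg (gcell X q)} :=
  if insub x is Some e then << e >> else 0.

Lemma cellchain_val q (e : gcell X q) : cellchain q (val e) = << e >>.
Proof. by rewrite /cellchain valK. Qed.

Lemma cellchain_dim q x : gdim x = q ->
  exists2 e : gcell X q, val e = x & cellchain q x = << e >>.
Proof.
by move=> /eqP xq; exists (exist _ x xq); rewrite -?cellchain_val.
Qed.

Lemma cellchain_inj q x y : gdim x = q -> gdim y = q ->
  cellchain q x = cellchain q y -> x = y.
Proof. by do 2!move=> /cellchain_dim[? <- ->]; move/freegU_inj->. Qed.

Lemma cellchain_neq q x : gdim x != q -> cellchain q x = 0.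
Proof. by move=> xq; rewrite /cellchain insubN. Qed.

Lemma bd_cellchain q x : gdim x = q.+1 ->
  gen_bd_fun (cellchain q.+1 x) =
  cellchain q (gface true x) - cellchain q (gface false x).
Proof.
by case/cellchain_dim => e <- ->; rewrite gen_bdU -!cellchain_val.
Qed.

(** For q above the dimension of x the truncated subtraction gives x itself,
    whose chain in dimension q is 0. *)
Definition atom_seq (x : X) : double_sequence A :=
  fun q a => cellchain q (iter (gdim x - q) (gface a) x).

Lemma atom_seq_dim x q a : atom_seq x q a =
  if (q <= gdim x)%N then cellchain q (iter (gdim x - q) (gface a) x) else 0.
Proof.
rewrite /atom_seq; case: leqP => // xq.
have /eqP -> : (gdim x - q == 0)%N by rewrite subn_eq0 ltnW.
by rewrite cellchain_neq// ltn_eqF.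
Qed.

Lemma atom_cell x q a : (q <= gdim x)%N ->
  exists2 e : gcell X q, val e = iter (gdim x - q) (gface a) x &
    atom_seq x q a = << e >>.
Proof.
move=> qx; apply: cellchain_dim; rewrite gdim_iter_face ?leq_subr//; lia.
Qed.

Lemma atom_in_nu x : in_nu (atom_seq x).
Proof.
split.
- move=> q a; case: (leqP q (gdim x)) => [qx|xq]; last first.
    by rewrite atom_seq_dim leqNgt xq; exact: gen_zero.
  have [e _ ->] := atom_cell a qx.
  by apply: gen_base; exists e.
- by exists (gdim x).+1 => q a xq; rewrite atom_seq_dim leqNgt xq.
- by move=> a; have [e _ ->] := @atom_cell x 0 a (leq0n _); exact: degU.
- move=> q a; rewrite !atom_seq_dim; case: (ltngtP q (gdim x)) => [qx|xq|qx].
  + have -> : (gdim x - q = (gdim x - q.+1).+1)%N by lia.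
    rewrite -[bd q _]/(gen_bd_fun _) bd_cellchain.
      by rewrite !gface_iter_face//; lia.
    by rewrite gdim_iter_face; lia.
  + by rewrite subrr [RHS]raddf0.
  + by rewrite qx subnn subrr [RHS]raddf0.
Qed.

Definition atom (x : X) : nu_obj A := exist _ _ (atom_in_nu x).

Lemma atom_globular : globular_relations atom.
Proof.
move=> a x; split=> [|x0]; apply: nu_eq => q b /=; rewrite /nu_src_tgt_seq !atom_seq_dim.
  by case: ltngtP => // ->; rewrite subnn.
rewrite gdim_face//; case: ltngtP => [qx|xq//|->].
- rewrite (ltnW (leq_trans qx (leq_pred _))).
  have -> : (gdim x - q = ((gdim x).-1 - q).-1.+2)%N by lia.
  have -> : ((gdim x).-1 - q = ((gdim x).-1 - q).-1.+1)%N by lia.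
  by rewrite !iterSr gface_gface//; lia.
- rewrite leq_pred subnn.
  by have -> : (gdim x - (gdim x).-1 = 1)%N by lia.
Qed.

Lemma atom_inj x y : gdim x = gdim y -> atom x = atom y -> x = y.
Proof.
move=> xy /(congr1 (fun z : nu_obj A => sval z (gdim y) true)) /=.
rewrite /atom_seq subnn; have -> : (gdim x - gdim y = 0)%N by rewrite xy subnn.
exact: cellchain_inj.
Qed.

End Atoms.

(** * Narrow elements of nu *)

Section NuStructure.
Variables (X : globular_set) (r : X -> nat).
Hypothesis rX : ranking r.
Local Notation A := (adc_of_globular_set X).
Local Notation rank := (rank r).
Implicit Types (x y z : nu_obj A).

Lemma nu_positive_chain z q a : positive_chain (sval z q a).
Proof. exact: (nu_positive (svalP z)). Qed.

Lemma nu_boundary z q a :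
  gen_bd_fun (sval z q.+1 a) = sval z q true - sval z q false.
Proof. exact/esym/(nu_bd (svalP z)). Qed.

(** Level m of the decomposition deals with m-narrow elements: they look like an
    element of the m-fold hom between two parallel m-cells. *)
Definition narrow m z := forall n a, (n <= m)%N ->
  exists e : gcell X n, sval z n a = << e >>.

(** The augmentation condition says that the components of dimension 0 have
    degree 1. *)
Lemma narrow0 z : narrow 0 z.
Proof.
move=> n a; rewrite leqn0 => /eqP ->.
apply: positive_deg1; first exact: nu_positive_chain.
exact: (nu_aug (svalP z)).
Qed.

Lemma rank_le_of_bd q (w : {freeg (gcell X q.+1)}) a b :
  positive_chain w -> gen_bd_fun w = << b >> - << a >> ->
  (rank a <= rank b)%N.
Proof.
move=> wpos bdw.
suff : 0 <= (rank b)%:Z - (rank a)%:Z by lia.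
have -> : (rank b)%:Z - (rank a)%:Z = weight (fun f => (rank f)%:Z) (gen_bd_fun w).
  by rewrite bdw raddfB /= !weightU.
rewrite weight_bd; apply: weight_ge0 => // e.
by have := rank_cell_face rX e; lia.
Qed.

Lemma support_bd q (a b f : gcell X q) : (rank a <= rank b)%N ->
  coeff f (<< b >> - << a >> : {freeg (gcell X q)}) != 0 ->
  (rank a <= rank f <= rank b)%N.
Proof.
move=> ab; rewrite coeffB !coeffU.
case: (eqVneq b f) => [<-|_]; first by rewrite leqnn andbT.
by case: (eqVneq a f) => [<-|_]; rewrite ?leqnn// subrr eqxx.
Qed.

(** Each component is bounded by the components of the previous dimension, so
    the bound given by the ends a and b propagates upwards. *)
Lemma narrow_support m z a b q s f :
  sval z m false = << a >> -> sval z m true = << b >> -> (m < q)%N ->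
  coeff f (sval z q s) != 0 -> (rank a < rank f < rank b)%N.
Proof.
move=> za zb; elim: q s f => [//|q IHq] s f mq fz.
have bdin e : coeff e (gen_bd_fun (sval z q.+1 s)) != 0 ->
    (rank a <= rank e <= rank b)%N.
  rewrite nu_boundary; move: mq; rewrite ltnS leq_eqVlt => /orP[/eqP mq|mq].
    subst m; rewrite zb za; apply: support_bd.
    apply: rank_le_of_bd (nu_positive_chain z q.+1 s) _.
    by rewrite nu_boundary zb za.
  rewrite coeffB => ez; suff /andP[/ltnW-> /ltnW-> //] : (rank a < rank e < rank b)%N.
  have [e0|e0] := eqVneq (coeff e (sval z q true)) 0; last exact: IHq e0.
  by apply: (IHq false) => //; move: ez; rewrite e0 sub0r oppr_eq0.
have [lo hi] := support_between rX (nu_positive_chain z q.+1 s) bdin fz.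
have := rank_cell_src rX f; have := rank_cell_tgt rX f; lia.
Qed.

Lemma no_rank_between q (e : gcell X q.+1) (f : gcell X q) :
  (rank (gcell_face false e) < rank f < rank (gcell_face true e))%N -> False.
Proof.
move=> /andP[lo hi].
have := @rank_tgt_le _ _ rX _ e (val f); have := @rank_src_ge _ _ rX _ e (val f).
rewrite gdim_cell leqnn => /(_ isT) ge /(_ isT) le.
have : rank e != rank f by apply: rank_neq => //; rewrite gdim_cell ltn_eqF.
rewrite neq_ltn => /orP[/le|/ge]; rewrite leqNgt => /negP; exact.
Qed.

(** The common target is the first q-cell after the common source. *)
Lemma next_cell_unique q (e e' : gcell X q.+1) :
  gcell_face false e = gcell_face false e' ->
  gcell_face true e = gcell_face true e'.
Proof.
move=> ee'; apply: (rank_cell_inj rX); apply/eqP.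
rewrite eqn_leq [X in X && _]leqNgt [X in _ && X]leqNgt; apply/andP; split; apply/negP => lt.
  by apply: (@no_rank_between _ e (gcell_face true e')); rewrite lt andbT ee' rank_cell_face.
by apply: (@no_rank_between _ e' (gcell_face true e)); rewrite lt andbT -ee' rank_cell_face.
Qed.

Lemma face_neq q (e : gcell X q.+1) : gcell_face true e != gcell_face false e.
Proof.
by apply/eqP => ee; have := rank_cell_face rX e; rewrite ee ltnn.
Qed.

(** A difference of two distinct generators determines both of them. *)
Lemma nu_cell_faces z q s (e : gcell X q.+1) a b :
  sval z q.+1 s = << e >> -> sval z q false = << a >> -> sval z q true = << b >> ->
  gcell_face false e = a /\ gcell_face true e = b.
Proof.
move=> ze za zb; have := nu_boundary z q s.
rewrite ze gen_bdU za zb => e1.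
by have [-> ->] := freegUB_inj (face_neq e) (esym e1).
Qed.

(** Above m there is no room for cells between a and a; below m each component
    is the face of the next one. *)
Lemma atom_of_equal_ends m z a : narrow m z ->
  sval z m false = << a >> -> sval z m true = << a >> -> z = atom (val a).
Proof.
move=> zm za zb; apply: nu_eq => q s.
rewrite [RHS]atom_seq_dim gdim_cell; case: leqP => [qm|mq]; last first.
  apply: freeg_eq0 => f; apply/eqP; apply: contraT => fz.
  by have := narrow_support za zb mq fz; lia.
move qk: (m - q)%N => k; elim: k q s qk qm => [|k IHk] q s qk qm.
  have -> : q = m by lia.
  by rewrite /= cellchain_val; case: s.
have [a0 za0] := zm q false qm; have [b0 zb0] := zm q true qm.
have [e ez] := zm q.+1 s (ltac:(lia)).
have [fa fb] := nu_cell_faces ez za0 zb0.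
have := IHk q.+1 s (ltac:(lia)) (ltac:(lia)).
have aq : gdim (iter k (gface s) (val a)) = q.+1.
  by rewrite gdim_iter_face gdim_cell; lia.
have [e' e'a ->] := cellchain_dim aq; rewrite ez => /freegU_inj ee'.
rewrite iterS -e'a -ee' -[gface s (val e)]/(val (gcell_face s e)) cellchain_val.
by case: s {ez e'a aq}; rewrite ?fa ?fb.
Qed.

End NuStructure.

(** * Decomposition of narrow elements *)

Section NuDecomposition.
Variables (X : globular_set) (r : X -> nat).
Hypothesis rX : ranking r.
Local Notation A := (adc_of_globular_set X).
Local Notation rank := (rank r).
Implicit Types (x y z : nu_obj A).

Lemma sval_ocomp n x y z q s : ocomp n x y z ->
  sval z q s = nu_comp_seq n (sval x) (sval y) q s.
Proof. by move=> /nu_ocompP[_ ->]. Qed.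

(** Above m the component of z is the sum of those of x, which lie before c, and
    those of y, which lie after c. *)
Lemma left_factor_restrict m x y z a b c q s : ocomp m x y z ->
  sval z m false = << a >> -> sval x m true = << c >> ->
  sval z m true = << b >> -> (m < q)%N ->
  sval x q s = restrict (below r (val c)) (sval z q s).
Proof.
move=> xyz za xc zb mq.
have yc : sval y m false = << c >> by move/nu_ocompP: xyz => [[_ <-] _].
have xa : sval x m false = << a >>.
  by rewrite -za (sval_ocomp _ _ xyz) /nu_comp_seq ltnn eqxx.
have yb : sval y m true = << b >>.
  by rewrite -zb (sval_ocomp _ _ xyz) /nu_comp_seq ltnn eqxx.
have -> : sval z q s = sval x q s + sval y q s.
  by rewrite (sval_ocomp _ _ xyz) /nu_comp_seq; case: ltngtP mq.
rewrite raddfD /= restrict_id ?restrict_eq0 ?addr0// => f.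
  by move=> /(narrow_support rX yc yb mq)/andP[cf _]; rewrite /below -leqNgt ltnW.
by move=> /(narrow_support rX xa xc mq)/andP[].
Qed.

(** As x is (m+1)-narrow, its component of dimension m+1 is a cell e starting at
    the end a of z, so the middle cell is the target of e, which depends only on
    a; by [left_factor_restrict] it determines both factors. *)
Lemma narrow_decomp_unique m x y x' y' z :
  narrow m.+1 x -> narrow m y -> ocomp m x y z ->
  narrow m.+1 x' -> narrow m y' -> ocomp m x' y' z -> x = x' /\ y = y'.
Proof.
move=> xm ym xyz xm' ym' xyz'.
have zx : sval z m false = sval x m false.
  by rewrite (sval_ocomp _ _ xyz) /nu_comp_seq ltnn eqxx.
have zx' : sval z m false = sval x' m false.
  by rewrite (sval_ocomp _ _ xyz') /nu_comp_seq ltnn eqxx.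
have zy : sval z m true = sval y m true.
  by rewrite (sval_ocomp _ _ xyz) /nu_comp_seq ltnn eqxx.
have zy' : sval z m true = sval y' m true.
  by rewrite (sval_ocomp _ _ xyz') /nu_comp_seq ltnn eqxx.
have [a za] := xm m false (leqnSn m); have [b zb] := ym m true (leqnn m).
have [c xc] := xm m true (leqnSn m); have [c' xc'] := xm' m true (leqnSn m).
have [e xe] := xm m.+1 true (leqnn _); have [e' xe'] := xm' m.+1 true (leqnn _).
have [ea ec] := nu_cell_faces rX xe za xc.
have [ea' ec'] := nu_cell_faces rX xe' (etrans (esym zx') (etrans zx za)) xc'.
have cc' : c = c' by rewrite -ec -ec'; apply: (next_cell_unique rX); rewrite ea.
(* From here on [za] and [zb] give the ends of z. *)
have {}za := etrans zx za; have {}zb := etrans zy zb.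
have xx' : x = x'.
  apply: nu_eq => q s; case: (ltngtP q m) => [qm|mq|->].
  - have := sval_ocomp q s xyz; rewrite (sval_ocomp q s xyz') /nu_comp_seq.
    by rewrite qm.
  - rewrite (left_factor_restrict _ xyz za xc zb mq).
    by rewrite (left_factor_restrict _ xyz' za xc' zb mq) cc'.
  - by case: s; rewrite ?xc ?xc' ?cc'// -zx zx'.
split=> //; subst x'; apply: nu_eq => q s; case: (ltngtP q m) => [qm|mq|->].
- move/nu_ocompP: xyz => [[+ _] _]; move/nu_ocompP: xyz' => [[+ _] _].
  by move=> /(_ q s qm) <- /(_ q s qm) <-.
- have := sval_ocomp q s xyz; rewrite (sval_ocomp q s xyz') /nu_comp_seq.
  by case: ltngtP mq => // _ _ /addrI.
- case: s; first by rewrite -zy zy'.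
  by move/nu_ocompP: xyz => [[_ <-] _]; move/nu_ocompP: xyz' => [[_ <-] _].
Qed.

(** The component of x in dimension m+1 is a cell, and positivity leaves no way
    to cancel it, whereas an atom of dimension m vanishes there. *)
Lemma atom_not_narrow_comp m x y c :
  narrow m.+1 x -> ocomp m x y (atom c) -> gdim c <> m.
Proof.
move=> xm xyz cm; have [e xe] := xm m.+1 true (leqnn _).
have : coeff e (sval (atom c) m.+1 true) = 0.
  by rewrite [sval _ _ _]atom_seq_dim cm ltnn coeff0.
rewrite (sval_ocomp _ _ xyz) /nu_comp_seq ltnNge leqnSn /= gtn_eqF//.
rewrite xe coeffD coeffU eqxx.
have := positive_coeff_ge0 e (nu_positive_chain y m.+1 true).
lia.
Qed.

Section Cut.
Variables (m : nat) (z : nu_obj A) (a b c : gcell X m).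
Hypotheses (za : sval z m false = << a >>) (zb : sval z m true = << b >>).
Hypotheses (ac : (rank a < rank c)%N) (cb : (rank c <= rank b)%N).

Let lower q s : {freeg (gcell X q)} := restrict (below r (val c)) (sval z q s).

Let bd_lower s : gen_bd_fun (lower m.+1 s) = << c >> - << a >>.
Proof.
apply: (bd_restrict_below rX _ ac cb).
by rewrite nu_boundary za zb.
Qed.

Let bd_lower_gt q s : (m < q)%N ->
  gen_bd_fun (lower q.+1 s) = lower q true - lower q false.
Proof.
move=> mq; rewrite -(restrict_below_bd rX) ?gdim_cell//.
by rewrite nu_boundary raddfB.
Qed.

(* The new end c is parallel to a, as c - a is a boundary. *)
Let bd_cut q : q.+1 = m -> gen_bd_fun (cellchain q.+1 (val c)) =
  sval z q true - sval z q false.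
Proof.
move=> qm; subst m; rewrite cellchain_val -(nu_boundary z q false) za.
by apply/eqP; rewrite -subr_eq0 -raddfB /= -(bd_lower true) gen_bd_bd.
Qed.

Definition cut_left_seq : double_sequence A := fun q s =>
  if (q < m)%N then sval z q s
  else if q == m then (if s then cellchain q (val c) else sval z q false)
  else lower q s.

Definition cut_right_seq : double_sequence A := fun q s =>
  if (q < m)%N then sval z q s
  else if q == m then (if s then sval z q true else cellchain q (val c))
  else sval z q s - lower q s.

Lemma cellchain_positive q (f : X) : positive_chain (cellchain q f).
Proof.
rewrite /cellchain; case: insubP => [e _ _|_]; last exact: gen_zero.
by apply: gen_base; exists e.
Qed.

Let lowerC q s : sval z q s - lower q s = restrict (predC (below r (val c))) (sval z q s).
Proof. by rewrite -{1}(restrictC (below r (val c)) (sval z q s)) addrC addKr. Qed.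

Lemma cut_left_in_nu : in_nu cut_left_seq.
Proof.
have [zpos [N zfin] zaug zbd] := svalP z; rewrite /cut_left_seq; split.
- move=> q s; case: ltngtP => _; first exact: zpos.
    exact/restrict_positive/zpos.
  by case: s; [exact: cellchain_positive | exact: zpos].
- exists (maxn N m.+1) => q s; rewrite geq_max => /andP[Nq mq].
  by case: ltngtP mq => // _ _; rewrite /lower zfin// raddf0.
- move=> s; case: ltngtP => // m0; case: s => //.
  have m0' : gdim (val c) = 0%N by rewrite gdim_cell.
  by have [e _ ->] := cellchain_dim m0'; exact: degU.
- move=> q s; case: (ltngtP q m) => [qm|mq|qm].
  + rewrite -[bd _ _]/(gen_bd_fun _).
    case: (ltngtP q.+1 m) => [qm'|mq|qm']; [exact: zbd|lia|].
    by case: s; [rewrite bd_cut|exact: zbd].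
  + rewrite ltnNge (leqW (ltnW mq)) /= gtn_eqF ?(leqW mq)//.
    exact/esym/bd_lower_gt.
  + rewrite -[bd _ _]/(gen_bd_fun _) ltnNge qm leqnSn /= gtn_eqF//.
    by subst m; rewrite bd_lower cellchain_val za.
Qed.

Lemma cut_right_in_nu : in_nu cut_right_seq.
Proof.
have [zpos [N zfin] zaug zbd] := svalP z; rewrite /cut_right_seq; split.
- move=> q s; case: ltngtP => _; first exact: zpos.
    by rewrite lowerC; exact/restrict_positive/zpos.
  by case: s; [exact: zpos | exact: cellchain_positive].
- exists (maxn N m.+1) => q s; rewrite geq_max => /andP[Nq mq].
  by case: ltngtP mq => // _ _; rewrite /lower zfin// raddf0 subr0.
- move=> s; case: ltngtP => // m0; case: s => //.
  have m0' : gdim (val c) = 0%N by rewrite gdim_cell.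
  by have [e _ ->] := cellchain_dim m0'; exact: degU.
- move=> q s; case: (ltngtP q m) => [qm|mq|qm].
  + rewrite -[bd _ _]/(gen_bd_fun _).
    case: (ltngtP q.+1 m) => [qm'|mq|qm']; [exact: zbd|lia|].
    by case: s; [exact: zbd|rewrite bd_cut].
  + rewrite ltnNge (leqW (ltnW mq)) /= gtn_eqF ?(leqW mq)// [RHS]raddfB.
    rewrite -zbd [X in _ = _ - X](bd_lower_gt s mq).
    by rewrite !opprB addrACA [- _ - _]addrC addrACA.
  + rewrite ltnNge qm leqnSn /= gtn_eqF// [RHS]raddfB -zbd.
    subst m; rewrite [X in _ = _ - X](bd_lower s) cellchain_val za zb.
    by rewrite opprB addrA subrK.
Qed.

Definition cut_left : nu_obj A := exist _ _ cut_left_in_nu.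
Definition cut_right : nu_obj A := exist _ _ cut_right_in_nu.

Lemma cut_ocomp : ocomp m cut_left cut_right z.
Proof.
apply/nu_ocompP; split.
  split=> [q s qm|]; rewrite /= /cut_left_seq /cut_right_seq; first by rewrite qm.
  by rewrite ltnn eqxx.
move=> q s; rewrite /nu_comp_seq /= /cut_left_seq /cut_right_seq.
by case: ltngtP => // _; [rewrite addrC subrK | case: s].
Qed.

Lemma narrow_cut_right : narrow m z -> narrow m cut_right.
Proof.
move=> zm n s nm; rewrite /= /cut_right_seq; case: ltngtP nm => // [nm|nm] _.
  by apply: zm; exact: ltnW.
case: s; first by apply: zm; rewrite nm.
by subst n; exists c; rewrite cellchain_val.
Qed.

Lemma narrow_cut_left (e : gcell X m.+1) : narrow m z ->
  gcell_face false e = a -> gcell_face true e = c -> narrow m.+1 cut_left.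
Proof.
move=> zm ea ec n s nm; rewrite /= /cut_left_seq; case: (ltngtP n m) => [nm'|nm'|nm'].
- by apply: zm; exact: ltnW.
- (* Every cell between a and c goes from a to c, since e does and no m-cell
     separates its faces. *)
  have {nm nm'}nm : n = m.+1 by lia.
  subst n.
  have lowpos : positive_chain (lower m.+1 s).
    exact/restrict_positive/nu_positive_chain.
  have [|//|f lf _] := parallel_single lowpos (bd_lower s); last 2 first.
  + by apply: contraTneq ac => ->; rewrite ltnn.
  + by exists f.
  move=> f fl.
  have bdin g : coeff g (gen_bd_fun (lower m.+1 s)) != 0 ->
      (rank a <= rank g <= rank c)%N.
    by rewrite bd_lower; apply: support_bd; exact: ltnW.
  have [lo hi] := support_between rX lowpos bdin fl.
  have lt := rank_cell_face rX f.
  split; apply: (rank_cell_inj rX); apply/eqP; rewrite eqn_leq ?lo ?hi ?andbT /=.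
    rewrite leqNgt; apply/negP => lt'.
    by apply: (@no_rank_between _ _ rX _ e (gcell_face false f)); rewrite ea ec; lia.
  rewrite leqNgt; apply/negP => lt'.
  by apply: (@no_rank_between _ _ rX _ e (gcell_face true f)); rewrite ea ec; lia.
- subst n; case: s; first by exists c; rewrite cellchain_val.
  exact: zm.
Qed.

End Cut.

(** The coefficient of a in the boundary b - a is -1, so some cell of z starts
    at a; its target is the first m-cell after a. *)
Lemma exists_first_cell m z a b :
  sval z m false = << a >> -> sval z m true = << b >> -> a != b ->
  exists e : gcell X m.+1, gcell_face false e = a /\
    (rank (gcell_face true e) <= rank b)%N.
Proof.
move=> za zb ab; set w := sval z m.+1 true.
have wpos : positive_chain w by exact: nu_positive_chain.
have bdw : gen_bd_fun w = << b >> - << a >> by rewrite nu_boundary za zb.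
have bdin g : coeff g (gen_bd_fun w) != 0 -> (rank a <= rank g <= rank b)%N.
  by rewrite bdw; apply: support_bd; exact: (rank_le_of_bd rX wpos bdw).
have [e [ew ea]] : exists e, coeff e w != 0 /\ gcell_face false e = a.
  apply: contrapT => no.
  have : coeff a (gen_bd_fun w) = -1.
    by rewrite bdw coeffB !coeffU eqxx eq_sym (negPf ab) mulr0 sub0r.
  rewrite coeff_weight weight_bd (@eq_in_weight _ _ (fun=> 0)) ?weight_const0//.
  move=> e ew; have [lo _] := support_between rX wpos bdin ew.
  have -> : gcell_face true e == a = false.
    by apply/negP => /eqP ea; have := rank_cell_face rX e; rewrite ea ltnNge lo.
  by case: eqVneq => // ea; case: no; exists e.
by exists e; split=> //; exact: (support_between rX wpos bdin ew).2.
Qed.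

End NuDecomposition.

(** * Evaluation of normal forms *)

Section Evaluation.
Variables (X : globular_set) (r : X -> nat).
Hypothesis rX : ranking r.
Local Notation A := (adc_of_globular_set X).
Variables (D : omega_category) (j : X -> D).
Hypothesis jrel : globular_relations j.
Implicit Types (x y z : nu_obj A) (d : D).

(** The decomposition of an m-narrow z is a list: it ends with an atom of
    dimension m, a unit for #_m, and its entries are (m+1)-narrow elements,
    decomposed at the next level. *)
Inductive eval : nat -> nu_obj A -> D -> Prop :=
| eval_atom m c : gdim c = m -> eval m (atom c) (j c)
| eval_comp m x y z dx dy dz : eval m.+1 x dx -> eval m y dy ->
    ocomp m x y z -> ocomp m dx dy dz -> eval m z dz.

Lemma eval_inv m z d : eval m z d ->
  (exists c, [/\ gdim c = m, z = atom c & d = j c]) \/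
  (exists x y dx dy, [/\ eval m.+1 x dx, eval m y dy, ocomp m x y z
                       & ocomp m dx dy d]).
Proof.
case=> {m z d} [m c cm|m x y z dx dy dz ex ey xyz dxyz]; first by left; exists c.
by right; exists x, y, dx, dy.
Qed.

(** Below the level of evaluation, the faces of z are atoms, on which the value
    is prescribed.  This provides the composability conditions in D. *)
Lemma eval_ends m z d n a : eval m z d -> (n <= m)%N ->
  exists s, [/\ gdim s = n, src_tgt n a z = atom s & src_tgt n a d = j s].
Proof.
move=> ev; elim: ev n a => {m z d} [m c cm|m x y z dx dy dz _ IHx _ IHy xyz dxyz] n a nm.
  subst m; exists (iter (gdim c - n) (gface a) c).
  rewrite gdim_iter_face ?leq_subr// subKn//.
  by rewrite !globular_relations_iter//; exact: atom_globular.
move: nm; rewrite leq_eqVlt => /orP[/eqP->|nm].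
  case: a; first by rewrite (tgt_ocomp xyz) (tgt_ocomp dxyz); exact: IHy.
  by rewrite (src_ocomp xyz) (src_ocomp dxyz); exact/IHx/leqnSn.
rewrite -(src_tgt_low false a z nm).1 -(src_tgt_low false a dz nm).1.
rewrite (src_ocomp xyz) (src_ocomp dxyz) !(src_tgt_low _ _ _ nm).1.
by apply: IHx; exact/ltnW/ltnW.
Qed.

Lemma eval_narrow m z d : eval m z d -> narrow m z.
Proof.
move=> ev n a nm; have [s [sn zs _]] := eval_ends a ev nm.
have /= := congr1 (fun u : nu_obj A => sval u n a) zs.
rewrite /nu_src_tgt_seq ltnn eqxx => ->; rewrite /atom_seq sn subnn /=.
by have [e _ ->] := cellchain_dim sn; exists e.
Qed.

Lemma eval_src_tgt m z d n a : eval m z d -> (m <= n)%N ->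
  eval m (src_tgt n a z) (src_tgt n a d).
Proof.
move=> ev; elim: ev n a => {m z d} [m c cm|m x y z dx dy dz ex IHx ey IHy xyz dxyz] n a mn.
  subst m; rewrite (src_tgt_ge a mn (atom_globular a c).1).
  by rewrite (src_tgt_ge a mn (jrel a c).1); exact: eval_atom.
move: mn; rewrite leq_eqVlt => /orP[/eqP mn|mn].
  subst n; have ez : eval m z dz by exact: eval_comp ex ey xyz dxyz.
  have [s [sm -> ->]] := eval_ends a ez (leqnn m).
  exact: eval_atom.
have nm : n <> m by move=> nm; rewrite nm ltnn in mn.
apply: eval_comp (IHx n a mn) (IHy n a (ltnW mn)) _ _; exact: src_tgt_ocomp.
Qed.

Lemma eval_fun m z d d' : eval m z d -> eval m z d' -> d = d'.
Proof.
move=> ev; elim: ev d' => {m z d} [m c cm|m x y z dx dy dz ex IHx ey IHy xyz dxyz] d' ev'.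
  have [[c' [c'm /esym cc' ->]]|[x [y [dx [dy [ex _ xyz _]]]]]] := eval_inv ev'.
    by congr j; apply: atom_inj (esym cc'); rewrite cm c'm.
  by case: (atom_not_narrow_comp (eval_narrow ex) xyz cm).
have [[c [cm zc _]]|[x' [y' [dx' [dy' [ex' ey' xyz' dxyz']]]]]] := eval_inv ev'.
  by rewrite zc in xyz; case: (atom_not_narrow_comp (eval_narrow ex) xyz cm).
have [xx' yy'] := narrow_decomp_unique rX (eval_narrow ex) (eval_narrow ey) xyz
  (eval_narrow ex') (eval_narrow ey') xyz'.
subst x' y'; rewrite -(IHx _ ex') -(IHy _ ey') in dxyz'.
exact: ocomp_fun dxyz dxyz'.
Qed.

(** Concatenation of the lists that decompose x and y, by associativity. *)
Lemma eval_concat m x y z dx dy dz : eval m x dx -> eval m y dy ->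
  ocomp m x y z -> ocomp m dx dy dz -> eval m z dz.
Proof.
move=> ev; elim: ev y z dy dz => {m x dx}
  [m c cm|m x1 x2 x d1 d2 dx e1 IH1 e2 IH2 x12 d12] y z dy dz ey xyz dxyz.
  subst m; rewrite (ocomp_unitl (leqnn _) (atom_globular true c).1 xyz).
  by rewrite (ocomp_unitl (leqnn _) (jrel true c).1 dxyz).
have [v x2y] : exists v, ocomp m x2 y v.
  by apply: ocomp_exists; rewrite -(tgt_ocomp x12) (ocomp_composable xyz).
have [dv d2y] : exists v, ocomp m d2 dy v.
  by apply: ocomp_exists; rewrite -(tgt_ocomp d12) (ocomp_composable dxyz).
apply: eval_comp e1 (IH2 _ _ _ _ ey x2y d2y) _ _.
  exact: ocompA x12 x2y xyz.
exact: ocompA d12 d2y dxyz.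
Qed.

(** For n > m, composable elements have the same decomposition at level m up to
    n-dimensional ends: uniqueness, applied to the common boundary d_n^+ x =
    d_n^- y, shows that the factors are pairwise composable under #_n, and the
    interchange law reassembles the composites. *)
Lemma eval_ocomp m n x y z dx dy dz : eval m x dx -> eval m y dy ->
  (m <= n)%N -> ocomp n x y z -> ocomp n dx dy dz -> eval m z dz.
Proof.
move=> ev; elim: ev y z dy dz n => {m x dx}
  [m c cm|m x1 x2 x d1 d2 dx ex1 IH1 ex2 IH2 x12 d12] y z dy dz n ey mn xyz dxyz.
  subst m; rewrite (ocomp_unitl mn (atom_globular true c).1 xyz).
  by rewrite (ocomp_unitl mn (jrel true c).1 dxyz).
have ex : eval m x dx by exact: eval_comp ex1 ex2 x12 d12.
move: mn; rewrite leq_eqVlt => /orP[/eqP mn|mn].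
  by subst n; exact: eval_concat ex ey xyz dxyz.
have [[c [cm yc dyc]]|[y1 [y2 [e1 [e2 [ey1 ey2 y12 e12]]]]]] := eval_inv ey.
  subst m y dy; rewrite (ocomp_unitr (ltnW mn) (atom_globular true c).1 xyz).
  by rewrite (ocomp_unitr (ltnW mn) (jrel true c).1 dxyz).
have nm : n <> m by move=> nm; rewrite nm ltnn in mn.
have tx1 := eval_src_tgt true ex1 mn; have tx2 := eval_src_tgt true ex2 (ltnW mn).
have sy1 := eval_src_tgt false ey1 mn; have sy2 := eval_src_tgt false ey2 (ltnW mn).
have tx := src_tgt_ocomp true nm x12; have sy := src_tgt_ocomp false nm y12.
rewrite (ocomp_composable xyz) in tx.
have [xy1 xy2] := narrow_decomp_unique rX (eval_narrow tx1) (eval_narrow tx2) tx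
  (eval_narrow sy1) (eval_narrow sy2) sy.
rewrite xy1 in tx1; rewrite xy2 in tx2.
have [z1 z1E] := ocomp_exists xy1; have [z2 z2E] := ocomp_exists xy2.
have [f1 f1E] := ocomp_exists (eval_fun tx1 sy1).
have [f2 f2E] := ocomp_exists (eval_fun tx2 sy2).
have mn' : m <> n by move=> e; exact: nm.
have [t tE z12] := interchange mn' x12 y12 z1E z2E.
have [dt dtE f12] := interchange mn' d12 e12 f1E f2E.
rewrite (ocomp_fun xyz tE) (ocomp_fun dxyz dtE).
apply: eval_comp (IH1 _ _ _ _ n ey1 mn z1E f1E) _ z12 f12.
exact: (IH2 _ _ _ _ n ey2 (ltnW mn) z2E f2E).
Qed.

(** Induction on the number of ranks between the ends, which decreases both for
    the left factor, one level higher, and for the right factor, at the same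
    level. *)
Lemma eval_exists m z : narrow m z -> exists d, eval m z d.
Proof.
move=> zm; have [a za] := zm m false (leqnn m); have [b zb] := zm m true (leqnn m).
move: {2}_.+1 (ltnSn (rank r b - rank r a)) => k.
elim: k m z a b zm za zb => [//|k IHk] m z a b zm za zb size_z.
have [ab|ab] := eqVneq a b.
  subst b; exists (j (val a)); rewrite (atom_of_equal_ends rX zm za zb).
  by apply: eval_atom; exact: gdim_cell.
have [e [ea eb]] := exists_first_cell rX za zb ab.
have ac : (rank r a < rank r (gcell_face true e))%N by rewrite -ea rank_cell_face.
set c := gcell_face true e in ac eb.
pose x := cut_left rX za zb ac eb; pose y := cut_right rX za zb ac eb.
have xyz : ocomp m x y z by exact: cut_ocomp.
have xm : narrow m.+1 x by exact: (narrow_cut_left rX za zb ac eb zm ea erefl).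
have ym : narrow m y by exact: narrow_cut_right.
have xa : sval x m false = << a >> by rewrite /= /cut_left_seq ltnn eqxx.
have xc : sval x m true = << c >> by rewrite /= /cut_left_seq ltnn eqxx cellchain_val.
have yc : sval y m false = << c >> by rewrite /= /cut_right_seq ltnn eqxx cellchain_val.
have yb : sval y m true = << b >> by rewrite /= /cut_right_seq ltnn eqxx.
have [f xf] := xm m.+1 false (leqnn _); have [g xg] := xm m.+1 true (leqnn _).
have fin : (rank r a < rank r f < rank r c)%N.
  apply: (narrow_support rX xa xc (ltnSn m) (s := false)).
  by rewrite xf coeffU eqxx.
have gin : (rank r a < rank r g < rank r c)%N.
  apply: (narrow_support rX xa xc (ltnSn m) (s := true)).
  by rewrite xg coeffU eqxx.
have [dx ex] : exists d, eval m.+1 x d by apply: IHk xf xg _ => //; lia.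
have [dy ey] : exists d, eval m y d by apply: IHk yc yb _ => //; lia.
have [s [sm xs dxs]] := eval_ends true ex (leqnSn m).
have [s' [sm' ys dys]] := eval_ends false ey (leqnn m).
have [dz dxyz] : exists dz, ocomp m dx dy dz.
  apply: ocomp_exists; rewrite dxs dys; congr j.
  by apply: atom_inj; rewrite ?sm ?sm'// -xs -ys (ocomp_composable xyz).
by exists dz; exact: eval_comp ex ey xyz dxyz.
Qed.

(** An element of level n is a one-entry list on the level below; the
    closing atom is its target. *)
Lemma eval_up m n z d : (m <= n)%N -> eval n z d -> eval m z d.
Proof.
move=> mn ev; rewrite -(subKn mn); elim: (n - m)%N => [|k IHk]; first by rewrite subn0.
have [kn|kn] := leqP n k; first by have -> : (n - k.+1 = n - k)%N by lia.
have nk : (n - k = (n - k.+1).+1)%N by lia.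
rewrite nk in IHk.
have [s [sm zs ds]] := eval_ends true IHk (leqnSn _).
apply: eval_comp IHk _ (ocomp_idr _ _) (ocomp_idr _ _).
by rewrite zs ds; exact: eval_atom.
Qed.

Lemma eval_morphism (g : omega_hom (nu_obj A) D) m z d :
  (forall c, sval g (atom c) = j c) -> eval m z d -> sval g z = d.
Proof.
case: g => g [gd gc] /= gj; elim=> {m z d} [m c _|m x y z dx dy dz _ gx _ gy xyz dxyz].
  exact: gj.
by have := gc _ _ _ _ xyz; rewrite gx gy => /ocomp_fun; apply.
Qed.

End Evaluation.

Lemma nu_free (X : globular_set) (r : X -> nat) : ranking r ->
  free_on (@atom X).
Proof.
move=> rX; split=> [|D j jrel]; first exact: atom_globular.
pose f z := sval (cid (eval_exists rX jrel (narrow0 z))).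
have fE z : eval j 0 z (f z) by exact: (svalP (cid _)).
have fval z d : eval j 0 z d -> f z = d by exact: (eval_fun rX jrel) (fE z).
have f_mor : omega_morphism (f : nu_obj (adc_of_globular_set X) -> D).
  split=> [n a z|n x y z xyz].
    exact/fval/(eval_src_tgt jrel).
  have [d dE] : exists d, ocomp n (f x) (f y) d.
    apply: ocomp_exists.
    rewrite -(fval _ _ (eval_src_tgt jrel true (fE x) (leq0n n))).
    rewrite -(fval _ _ (eval_src_tgt jrel false (fE y) (leq0n n))).
    by rewrite (ocomp_composable xyz).
  by rewrite (fval z d) //; apply: (eval_ocomp rX jrel (fE x) (fE y) (leq0n n) xyz dE).
exists (exist _ f f_mor); split=> [c|g gj] /=.
  by apply: fval; apply: (eval_up jrel (leq0n (gdim c))); exact: eval_atom.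
case: g gj => g gmor gj; apply: eq_exist; apply: funext => z /=.
exact/esym/(eval_morphism (g := exist _ g gmor) gj (fE z)).
Qed.

(** * Free omega-categories and morphisms out of nu *)

Section FreeOmegaCategories.

Lemma globular_relations_comp (X : globular_set) (C D : omega_category)
    (i : X -> C) (f : omega_hom C D) :
  globular_relations i -> globular_relations (fun x => sval f (i x)).
Proof.
case: f => f [fd _] irel a x /=; have [ix iface] := irel a x.
by rewrite -!fd ix; split=> // x0; rewrite iface.
Qed.

Lemma free_hom_ext (X : globular_set) (C D : omega_category) (i : X -> C)
    (f g : omega_hom C D) :
  free_on i -> (forall x, sval f (i x) = sval g (i x)) -> f = g.
Proof.
move=> [irel iuniv] fg.
have [h [hi huniq]] := iuniv D _ (globular_relations_comp g irel).
by rewrite -(huniq f fg) -(huniq g).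
Qed.

Lemma free_on_isomorphic (X : globular_set) (C C' : omega_category)
    (i : X -> C) (i' : X -> C') :
  free_on i -> free_on i' -> @isomorphic OmegaCat C C'.
Proof.
move=> free free'; have [irel iuniv] := free; have [irel' iuniv'] := free'.
have [f [fi _]] := iuniv _ _ irel'; have [f' [fi' _]] := iuniv' _ _ irel.
exists f, f'; split.
  by apply: (free_hom_ext free) => x /=; rewrite fi fi'.
by apply: (free_hom_ext free') => x /=; rewrite fi' fi.
Qed.

Lemma free_on_transport (X : globular_set) (C C' : omega_category) (i : X -> C) :
  free_on i -> @isomorphic OmegaCat C C' -> exists i' : X -> C', free_on i'.
Proof.
move=> free [u [v [vu uv]]]; have [irel iuniv] := free.
exists (fun x => sval u (i x)); split=> [|D j jrel].
  exact: globular_relations_comp.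
have vuE x : sval v (sval u x) = x by rewrite -[RHS]/(sval (idm (C : OmegaCat)) x) -vu.
have [f [fi _]] := iuniv _ _ jrel.
exists (ccomp (f : @hom OmegaCat C D) v); split=> [x|g gj]; first by rewrite /= vuE.
have gu : ccomp (g : @hom OmegaCat C' D) u = f.
  by apply: (free_hom_ext free) => x; rewrite fi -gj.
by rewrite -gu -ccompA uv ccomp_idr.
Qed.

End FreeOmegaCategories.

Section FullFaithful.
Variables (X : globular_set) (r : X -> nat).
Hypothesis rX : ranking r.
Variable L : adc.
Local Notation A := (adc_of_globular_set X).

Lemma nu_faithful_of_globular (f g : adc_hom A L) : nu_map f =1 nu_map g -> f = g.
Proof.
case: f g => [f fmor] [g gmor] /= fg; apply: eq_exist.
apply: functional_extensionality_dep => q; apply: funext => w.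
pose F : {additive A q -> L q} := HB.pack (f q)
  (GRing.isZmodMorphism.Build (A q) (L q) (f q) (@amor_additive _ _ _ fmor q)).
pose G : {additive A q -> L q} := HB.pack (g q)
  (GRing.isZmodMorphism.Build (A q) (L q) (g q) (@amor_additive _ _ _ gmor q)).
rewrite -[LHS]/(F w) -[RHS]/(G w); apply: freeg_additive_ext => e.
have := congr1 (fun z : nu_obj L => sval z q true) (fg (atom (val e))).
by rewrite /= /atom_seq gdim_cell subnn /= cellchain_val.
Qed.

Section Full.
Variable g : omega_hom (nu_obj A) (nu_obj L).

(** The sign chosen here is immaterial: g (atom e) equals its own q-dimensional
    faces, so both of its components in dimension q agree. *)
Definition chain_map q (w : {freeg (gcell X q)}) : L q :=
  extend (fun e : gcell X q => sval (sval g (atom (val e))) q true) w.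

Lemma chain_mapU q (e : gcell X q) a c :
  src_tgt q a (atom c) = atom (val e) ->
  chain_map << e >> = sval (sval g (atom c)) q a.
Proof.
rewrite /chain_map extendU => <-; case: g => h [hd _] /=.
by rewrite hd /= /nu_src_tgt_seq ltnn eqxx.
Qed.

HB.instance Definition _ q :=
  GRing.isZmodMorphism.Build {freeg (gcell X q)} (L q) (@chain_map q)
    (extend_is_zmod_morphism _).

Lemma chain_map_morphism : @adc_morphism A L chain_map.
Proof.
split.
- by move=> q; exact: extend_is_zmod_morphism.
- move=> q w; apply: (freeg_additive_ext
    (f := @chain_map q \o @gen_bd_fun X q)
    (g := @bd L q \o @chain_map q.+1)) => e /=.
  have bd_e : bd q (chain_map << e >>) =
      sval (sval g (atom (val e))) q true - sval (sval g (atom (val e))) q false.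
    by rewrite /chain_map extendU -(nu_bd (svalP (sval g (atom (val e))))).
  have face a : src_tgt q a (atom (val e)) = atom (val (gcell_face a e)).
    have [_ ] := atom_globular a (val e); rewrite gdim_cell; exact.
  by rewrite gen_bdU raddfB /= bd_e -!(chain_mapU (face _)).
- move=> w; apply: (freeg_additive_ext
    (f := @aug L \o @chain_map 0) (g := @deg (gcell X 0))) => e /=.
  by rewrite degU /chain_map extendU (nu_aug (svalP (sval g (atom (val e))))).
- move=> q w; elim=> [_ [e ->]||w1 w2 _ pos1 _ pos2].
  + by rewrite /chain_map extendU; exact: (nu_positive (svalP (sval g (atom (val e))))).
  + by rewrite raddf0; exact: positive0.
  + by rewrite raddfD; exact: positiveD.
Qed.

Definition chain_hom : adc_hom A L := exist _ _ chain_map_morphism.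

(** Both sides agree on the atoms, because each component of an atom is the top
    component of an iterated face. *)
Lemma nu_chain_hom : exist _ (nu_map chain_hom) (nu_map_morphism chain_hom) = g.
Proof.
apply: (free_hom_ext (nu_free rX)) => c /=; apply: nu_eq => q a /=.
rewrite atom_seq_dim; case: leqP => [qc|cq].
  have sc := globular_relations_iter a (@atom_globular X) qc.
  have gc : gdim (iter (gdim c - q) (gface a) c) = q.
    by rewrite gdim_iter_face ?leq_subr// subKn.
  have [e ec ->] := cellchain_dim gc.
  by apply: chain_mapU; rewrite sc ec.
rewrite raddf0 -(atom_globular a c).1.
have [hd _] := svalP g.
by rewrite hd /= /nu_src_tgt_seq; case: ltngtP cq.
Qed.

End Full.
End FullFaithful.

(** The case of the complex generated by a simple globular set, transported
    along the isomorphism that makes K simple. *)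
Lemma nu_full_faithful (K L : adc) : simple_adc K ->
  (forall g : @hom OmegaCat (nu K) (nu L), exists f : @hom ADC K L, fmap nu f = g) /\
  injective (fun f : @hom ADC K L => fmap nu f).
Proof.
move=> [X [/simple_ranking[r rX] [u [v [vu uv]]]]]; split=> [g|f f' ff'].
  exists (ccomp (chain_hom (ccomp g (fmap nu v)) : @hom ADC _ L) u).
  rewrite fmap_comp [X in ccomp X _](nu_chain_hom rX).
  by rewrite -ccompA -fmap_comp vu fmap_id ccomp_idr.
rewrite -(ccomp_idr f) -(ccomp_idr f') -vu !ccompA; congr (ccomp _ u).
apply: nu_faithful_of_globular => x.
rewrite -[nu_map _ x]/(sval (fmap nu (ccomp f v)) x).
rewrite -[nu_map _ x]/(sval (fmap nu (ccomp f' v)) x) !fmap_comp.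
by rewrite (ff' : fmap nu f = fmap nu f').
Qed.

Lemma nu_simple_is_simple (K : SimpleADC) : simple_omega_category (nu_simple K).
Proof.
case: K => K [X [sX iso]]; have [r rX] := simple_ranking sX.
have iso' := functor_isomorphic nu (isomorphic_sym iso).
by have [i' free] := free_on_transport (nu_free rX) iso'; exists X, i'.
Qed.

Lemma simple_is_nu_simple (C : OmegaCat) : simple_omega_category C ->
  exists K : SimpleADC, isomorphic (nu_simple K) C.
Proof.
move=> [X [i [sX free]]]; have [r rX] := simple_ranking sX.
have sA : simple_adc (adc_of_globular_set X).
  by exists X; split=> //; exists (idm _), (idm _); rewrite !ccomp_idl.
exists (exist _ _ sA); exact: free_on_isomorphic (nu_free rX) free.
Qed.

(** * The theorem *)

Theorem theorem3p4 :
  fully_faithful_embedding nu_simple /\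
  equivalent_categories (image nu_simple) Theta.
Proof.
have Nfull : full nu_simple.
  by move=> [K sK] [L sL] g; exact: (nu_full_faithful L sK).1.
have Nfaithful : faithful nu_simple.
  by move=> [K sK] [L sL]; exact: (nu_full_faithful L sK).2.
split; first by split=> //; exact: full_faithful_reflects_iso.
apply: image_equivalent_full_subcategory => //.
  exact: nu_simple_is_simple.
exact: simple_is_nu_simple.
Qed.
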